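(* Given $\alpha>0$, $p\in[1,\infty)$, and a positive function $\gamma\in C_0(\mathbb R_+)$, there exists a function $f\in L^p(\mathbb R_+)$ such that (a) the Laplace transform $\widehat f$ admits an analytic extension to the region $$\Omega:=\{z\in\mathbb C:\operatorname{Re}z>-1/(1+|\operatorname{Im}z|)^\alpha\},$$ with $$|\widehat f(z)|\le(1+|\operatorname{Im}z|)^{\alpha/2},\qquad z\in\Omega,$$ and (b) $$\int_0^\infty\Big|\widehat f(0)-\int_0^t f(s)\,ds\Big|^p\Big(\frac{t}{\gamma(t)\log(t+2)}\Big)^{p/\alpha}\,dt=\infty.$$
   Context: $\mathbb R_+=[0,\infty)$; $C_0(\mathbb R_+)$ is the space of continuous functions on $\mathbb R_+$ tending to $0$ at infinity; functions in $L^p(\mathbb R_+)$ are complex-valued. $\widehat f(\lambda)=\int_0^\infty e^{-\lambda t}f(t)\,dt$, holomorphic on $\{\operatorname{Re}\lambda>0\}$; the same symbol denotes its holomorphic extension. *)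

(* Defs.v *)
From HB Require Import structures.
From mathcomp Require Import all_boot all_order all_algebra.
From mathcomp Require Import complex.
From mathcomp Require Import all_classical all_reals all_analysis.

Set Implicit Arguments.
Unset Strict Implicit.
Unset Printing Implicit Defensive.

Import Order.TTheory GRing.Theory Num.Theory.
Import numFieldNormedType.Exports.

Local Open Scope classical_set_scope.
Local Open Scope ring_scope.

Section Defs.
Context {R : realType}.
Local Notation C := (complex R).
Local Notation mu := (@lebesgue_measure R).

Definition Rplus : set R := `[0, +oo[.

(* The R-valued modulus; the norm `|z| of the numFieldType R[i] lies in R[i]. *)
Definition cmod (z : C) : R := ComplexField.Normc.normc z.

Definition cexp (z : C) : C :=
  Complex (expR (complex.Re z) * cos (complex.Im z))
          (expR (complex.Re z) * sin (complex.Im z)).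

Definition cintegral (D : set R) (f : R -> C) : C :=
  Complex (\int[mu]_(t in D) complex.Re (f t))
          (\int[mu]_(t in D) complex.Im (f t)).

(* Only the values on [0, +oo[ matter. *)
Definition Lp_Rplus (p : R) (f : R -> C) : Prop :=
  [/\ measurable_fun Rplus (fun t => complex.Re (f t)),
      measurable_fun Rplus (fun t => complex.Im (f t)) &
      (\int[mu]_(t in Rplus) ((cmod (f t) `^ p)%:E) < +oo)%E].

Definition C0_Rplus (g : R -> R) : Prop :=
  {within Rplus, continuous g} /\ g t @[t --> +oo] --> (0 : R).

(* The integral converges absolutely for f in L^p and Re z > 0; elsewhere
   the value of this total function is not meaningful. *)
Definition laplace (f : R -> C) (z : C) : C :=
  cintegral Rplus (fun t => cexp (- (z * Complex t 0)) * f t).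

(* The scalar field is R[i], so the difference quotient runs over complex
   increments: derivability in the direction 1 is complex differentiability. *)
Definition holomorphic_on (U : set C) (F : C -> C) : Prop :=
  forall z : C, U z -> derivable (F : C^o -> C^o) (z : C^o) (1 : C^o).

Definition right_half_plane : set C := [set z | 0 < complex.Re z].

Definition Omega (alpha : R) : set C :=
  [set z | - (1 / (1 + `|complex.Im z|) `^ alpha) < complex.Re z].

Definition laplace_extension (f : R -> C) (U : set C) (F : C -> C) : Prop :=
  [/\ right_half_plane `<=` U,
      holomorphic_on U F &
      forall z, right_half_plane z -> F z = laplace f z].

End Defs.

(* Main.v *)
Require Import Defs.
From HB Require Import structures.
From mathcomp Require Import all_boot all_order all_algebra.
From mathcomp Require Import complex.
From mathcomp Require Import all_classical all_reals all_analysis.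
From mathcomp Require Import measurable_realfun.
From mathcomp Require Import ring lra zify.

Set Implicit Arguments.
Unset Strict Implicit.
Unset Printing Implicit Defensive.

Import Order.TTheory GRing.Theory Num.Theory.
Import numFieldNormedType.Exports.

Local Open Scope classical_set_scope.
Local Open Scope ring_scope.

(** Put g(t) = f^(0) - int_0^t f, so that f = - g' and f^ = - z g^ when f^(0) = 0.
    The function g is a series of humps
      a (e t / k)^k e^(-t) e^(i s t),
    each of height a, width sqrt k, location k and frequency s, the frequency
    being tied to the location by s^alpha = A k / ln k.

    Why the integral diverges.  The L^p norm of the corresponding piece of f is
    of order s a k^(1/(2p)), because differentiation costs a factor s.  Near
    t = k the weight (t / ln t)^(1/alpha) is of order s as well, so the weighted
    norm of the piece of g is the same number times gamma(k)^(-1/alpha).  As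
    gamma tends to 0, a hump whose derivative has a small L^p norm d has a weighted
    norm as large as desired once k is large ([weighted_amp_ge], [near_gamma_le]).

    Why the transform obeys the bound.  The transform of one piece is the
    rational function - c z / (z + 1 - i s)^(k+1), holomorphic for Re z > -1 and
    hence on Omega, and c is controlled by the mass a sqrt k of the hump
    ([bump_mass]).  Away from the frequency |z + 1 - i s| >= 2 and the power is
    exponentially small.  Near it |z + 1 - i s| >= 1 + Re z >= 1 - C ln k / k, so
    the power is at most a small power of k, and the transform is at most of order
    d k^(1/2 - 1/(2p) + 1/(4p)), while (1 + |Im z|)^(alpha/2) is of order
    sqrt (k / ln k): the factor k^(-1/(4p)) left over beats the logarithm
    ([near_hump_transform_le]).

    The humps are superposed with d = 4^-(n+1) and with locations chosen one
    after the other, so sparsely that at the location of one hump all the others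
    together are negligible ([sparse_choice], [hump_sum_ge]).  The transforms
    have summable second-order Taylor remainders, which gives holomorphy of the
    sum by elementary means ([derivable_csum], [holomorphic_transform_sum]). *)

Arguments cmod : simpl never.

(** * The complex modulus and exponential *)

Section ComplexModulus.
Context {R : realType}.
Local Notation C := (complex R).
Implicit Types z w : C.

Lemma ReD z w : complex.Re (z + w) = complex.Re z + complex.Re w.
Proof. by case: z; case: w. Qed.
Lemma ImD z w : complex.Im (z + w) = complex.Im z + complex.Im w.
Proof. by case: z; case: w. Qed.
Lemma ReN z : complex.Re (- z) = - complex.Re z.
Proof. by case: z. Qed.
Lemma ImN z : complex.Im (- z) = - complex.Im z.
Proof. by case: z. Qed.
Lemma ReM z w : complex.Re (z * w) =
  complex.Re z * complex.Re w - complex.Im z * complex.Im w.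
Proof. by case: z; case: w. Qed.
Lemma ImM z w : complex.Im (z * w) =
  complex.Re z * complex.Im w + complex.Im z * complex.Re w.
Proof. by case: z; case: w. Qed.

Lemma complex_ext z w :
  complex.Re z = complex.Re w -> complex.Im z = complex.Im w -> z = w.
Proof. by case: z; case: w => a b c d /= -> ->. Qed.

Lemma cmodE z : cmod z = Num.sqrt (complex.Re z ^+ 2 + complex.Im z ^+ 2).
Proof. by case: z. Qed.

Lemma cmod_ge0 z : 0 <= cmod z.
Proof. by rewrite cmodE sqrtr_ge0. Qed.

Lemma cmod0 : cmod (0 : C) = 0.
Proof. by rewrite cmodE /= expr0n /= addr0 sqrtr0. Qed.

Lemma cmodM z w : cmod (z * w) = cmod z * cmod w.
Proof. exact: ComplexField.Normc.normcM. Qed.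

Lemma cmodV z : cmod z^-1 = (cmod z)^-1.
Proof. exact: ComplexField.Normc.normcV. Qed.

Lemma cmodD z w : cmod (z + w) <= cmod z + cmod w.
Proof. exact: le_normcD. Qed.

Lemma cmodN z : cmod (- z) = cmod z.
Proof. exact: normcN. Qed.

Lemma cmodB z w : cmod (z - w) <= cmod z + cmod w.
Proof. by rewrite (le_trans (cmodD _ _)) // cmodN. Qed.

Lemma cmodX z n : cmod (z ^+ n) = cmod z ^+ n.
Proof.
elim: n => [|n IH]; last by rewrite !exprS cmodM IH.
by rewrite !expr0 cmodE /= expr0n /= expr1n addr0 sqrtr1.
Qed.

Lemma cmod_real (x : R) : cmod (Complex x 0) = `|x|.
Proof. by rewrite cmodE /= expr0n /= addr0 sqrtr_sqr. Qed.

Lemma le_Re_cmod z : `|complex.Re z| <= cmod z.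
Proof. by rewrite cmodE -sqrtr_sqr ler_wsqrtr // lerDl sqr_ge0. Qed.

Lemma le_Im_cmod z : `|complex.Im z| <= cmod z.
Proof. by rewrite cmodE -sqrtr_sqr ler_wsqrtr // lerDr sqr_ge0. Qed.

Lemma le_cmod_ReIm z : cmod z <= `|complex.Re z| + `|complex.Im z|.
Proof.
case: z => x y; have -> : Complex x y = Complex x 0 + Complex 0 y :> C.
  by apply: complex_ext; rewrite ?ReD ?ImD /= ?addr0 ?add0r.
rewrite (le_trans (cmodD _ _)) // cmod_real ReD ImD /= addr0 add0r lerD2l.
by rewrite cmodE /= expr0n /= add0r sqrtr_sqr.
Qed.

Lemma cmod_norm z : `|z| = Complex (cmod z) 0 :> C.
Proof. by rewrite normc_def cmodE. Qed.

Lemma cmod_eq0 z : (cmod z == 0) = (z == 0).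
Proof.
by apply/eqP/eqP => [/ComplexField.Normc.eq0_normc //|->]; rewrite cmod0.
Qed.

Lemma cmod_sum (u : nat -> C) N :
  cmod (\sum_(0 <= i < N) u i) <= \sum_(0 <= i < N) cmod (u i).
Proof.
elim: N => [|N IH]; first by rewrite !big_geq // cmod0.
by rewrite !big_nat_recr //= (le_trans (cmodD _ _)) // lerD2r.
Qed.

Lemma complex_natr (n : nat) : (n%:R : C) = Complex n%:R 0.
Proof.
elim: n => [//|n IH]; apply: complex_ext; rewrite -[in LHS]addn1 natrD IH.
  by rewrite ReD /= -natr1.
by rewrite ImD /= addr0.
Qed.

Lemma cmod_natr n : cmod (n%:R : C) = n%:R.
Proof. by rewrite complex_natr cmod_real ger0_norm. Qed.

Lemma Re_sum (u : nat -> C) N :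
  complex.Re (\sum_(0 <= i < N) u i) = \sum_(0 <= i < N) complex.Re (u i).
Proof.
elim: N => [|N IH]; first by rewrite !big_geq.
by rewrite !big_nat_recr //= ReD IH.
Qed.

Lemma Im_sum (u : nat -> C) N :
  complex.Im (\sum_(0 <= i < N) u i) = \sum_(0 <= i < N) complex.Im (u i).
Proof.
elim: N => [|N IH]; first by rewrite !big_geq.
by rewrite !big_nat_recr //= ImD IH.
Qed.

Lemma cexpD z w : cexp (z + w) = cexp z * cexp w.
Proof.
apply: complex_ext; rewrite /= ?ReM ?ImM /= ReD ImD expRD ?cosD ?sinD; ring.
Qed.

Lemma cmod_cexp z : cmod (cexp z) = expR (complex.Re z).
Proof.
by rewrite cmodE /= !exprMn -mulrDr cos2Dsin2 mulr1 sqrtr_sqr ger0_norm ?expR_ge0.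
Qed.

End ComplexModulus.

(** * Complex series with a geometric majorant *)

Section ComplexSeries.
Context {R : realType}.
Local Notation C := (complex R).
Implicit Types u v : nat -> C.

Definition geometric_bound u :=
  exists B : R, forall n, cmod (u n) <= B * 2^-1 ^+ n.

(** Taken componentwise, so that convergence is a matter of real series. *)
Definition csum u : C :=
  Complex (limn (series (fun n => complex.Re (u n))))
          (limn (series (fun n => complex.Im (u n)))).

Lemma geometric_boundM (a : C) u :
  geometric_bound u -> geometric_bound (fun n => a * u n).
Proof.
case=> B hB; exists (cmod a * B) => n.
by rewrite cmodM -mulrA ler_wpM2l // cmod_ge0.
Qed.

Lemma geometric_boundD u v : geometric_bound u -> geometric_bound v ->
  geometric_bound (fun n => u n + v n).
Proof.
case=> B hB [B' hB']; exists (B + B') => n.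
by rewrite (le_trans (cmodD _ _)) // mulrDl lerD.
Qed.

(** The finitely many exceptional terms only enlarge the constant. *)
Lemma geometric_bound_near u (B : R) (N : nat) :
  (forall n, (N <= n)%N -> cmod (u n) <= B * 2^-1 ^+ n) -> geometric_bound u.
Proof.
move=> hB; exists (`|B| + \sum_(0 <= i < N) cmod (u i) * 2 ^+ i) => n.
have S0 M : 0 <= \sum_(0 <= i < M) cmod (u i) * 2 ^+ i :> R.
  by apply: sumr_ge0 => i _; rewrite mulr_ge0 ?cmod_ge0 ?exprn_ge0.
have h2 : 0 <= 2^-1 ^+ n :> R by rewrite exprn_ge0 // invr_ge0.
have [Nn|nN] := leqP N n.
  rewrite (le_trans (hB _ Nn)) // ler_wpM2r // (le_trans (ler_norm _)) //.
  by rewrite lerDl.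
apply: (@le_trans _ _ ((cmod (u n) * 2 ^+ n) * 2^-1 ^+ n)).
  by rewrite -mulrA -exprMn mulfV ?pnatr_eq0 // expr1n mulr1.
rewrite ler_wpM2r // (le_trans (_ : _ <= \sum_(0 <= i < N) cmod (u i) * 2 ^+ i)) //; last first.
  by rewrite lerDr.
rewrite big_mkord (bigD1 (Ordinal nN)) //= lerDl; apply: sumr_ge0 => i _.
by rewrite mulr_ge0 ?cmod_ge0 ?exprn_ge0.
Qed.

Lemma is_cvg_series_half (v : nat -> R) (B : R) :
  (forall n, `|v n| <= B * 2^-1 ^+ n) -> cvgn (series v).
Proof.
move=> hv; apply: normed_cvg; apply: (@series_le_cvg _ _ (geometric B 2^-1)).
- by move=> n /=.
- by move=> n /=; rewrite (le_trans _ (hv n)).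
- by move=> n /=; rewrite (le_trans (hv n)).
by apply: is_cvg_geometric_series; rewrite ger0_norm // ?invf_lt1 // ?ltr1n.
Qed.

Lemma csum_Re u : geometric_bound u ->
  series (fun n => complex.Re (u n)) n @[n --> \oo] --> complex.Re (csum u).
Proof.
case=> B hB; apply: (@is_cvg_series_half _ B) => n.
exact: le_trans (le_Re_cmod _) (hB n).
Qed.

Lemma csum_Im u : geometric_bound u ->
  series (fun n => complex.Im (u n)) n @[n --> \oo] --> complex.Im (csum u).
Proof.
case=> B hB; apply: (@is_cvg_series_half _ B) => n.
exact: le_trans (le_Im_cmod _) (hB n).
Qed.

(** Closed discs pass to the limit: every estimate on the partial sums is
    inherited by the sum. *)
Lemma csum_closed u (w : C) (S : R) : geometric_bound u ->
  (\forall N \near \oo, cmod (\sum_(0 <= i < N) u i - w) <= S) ->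
  cmod (csum u - w) <= S.
Proof.
move=> gu hS.
have cv : cmod (\sum_(0 <= i < N) u i - w) @[N --> \oo] --> cmod (csum u - w).
  rewrite cmodE; under eq_fun do rewrite cmodE.
  apply: continuous_cvg; first exact: sqrt_continuous.
  have cR : complex.Re (\sum_(0 <= i < N) u i - w) @[N --> \oo]
      --> complex.Re (csum u - w).
    rewrite ReD; under eq_fun do rewrite ReD Re_sum.
    by apply: cvgD; [exact: csum_Re|exact: cvg_cst].
  have cI : complex.Im (\sum_(0 <= i < N) u i - w) @[N --> \oo]
      --> complex.Im (csum u - w).
    rewrite ImD; under eq_fun do rewrite ImD Im_sum.
    by apply: cvgD; [exact: csum_Im|exact: cvg_cst].
  rewrite !expr2; under eq_fun do rewrite !expr2.
  by apply: cvgD; apply: cvgM.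
rewrite -(cvg_lim _ cv) //; apply: limr_le => //.
by apply/cvg_ex; eexists; exact: cv.
Qed.

Lemma csum_lin (a : C) u v : geometric_bound u -> geometric_bound v ->
  csum (fun n => a * u n + v n) = a * csum u + csum v.
Proof.
move=> gu gv; have gw := geometric_boundD (geometric_boundM a gu) gv.
have [uR uI vR vI] := And4 (csum_Re gu) (csum_Im gu) (csum_Re gv) (csum_Im gv).
apply: complex_ext.
  apply: (cvg_unique _ (csum_Re gw)) => //.
  rewrite ReD ReM.
  rewrite (_ : series _ = fun N =>
    complex.Re a * series (fun n => complex.Re (u n)) N -
    complex.Im a * series (fun n => complex.Im (u n)) N +
    series (fun n => complex.Re (v n)) N); last first.
    apply/funext => N; rewrite /series /= !mulr_sumr -sumrB -big_split /=.
    by apply: eq_bigr => i _; rewrite ReD ReM.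
  by apply: cvgD => //; apply: cvgB; apply: cvgMr.
apply: (cvg_unique _ (csum_Im gw)) => //.
rewrite ImD ImM.
rewrite (_ : series _ = fun N =>
  complex.Re a * series (fun n => complex.Im (u n)) N +
  complex.Im a * series (fun n => complex.Re (u n)) N +
  series (fun n => complex.Im (v n)) N); last first.
  apply/funext => N; rewrite /series /= !mulr_sumr -2!big_split /=.
  by apply: eq_bigr => i _; rewrite ImD ImM.
by apply: cvgD => //; apply: cvgD; apply: cvgMr.
Qed.

Lemma csum0 : csum (fun=> 0 : C) = 0.
Proof.
by apply: complex_ext => /=; apply/cvg_lim => //; rewrite /series /=;
  under eq_fun do rewrite big1_eq; exact: cvg_cst.
Qed.

Lemma csumZ (a : C) (u : nat -> C) : geometric_bound u ->
  csum (fun n => a * u n) = a * csum u.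
Proof.
move=> gu; rewrite -[RHS]addr0 -csum0 -csum_lin //.
  by congr csum; apply/funext => n; rewrite addr0.
by exists 0 => n; rewrite cmod0 mul0r.
Qed.

End ComplexSeries.

(** * Term-by-term complex differentiation *)

Section Holomorphy.
Context {R : realType}.
Local Notation C := (complex R).

Lemma sum_half_le (N : nat) : \sum_(0 <= i < N) 2^-1 ^+ i <= 2 :> R.
Proof.
have -> : \sum_(0 <= i < N) 2^-1 ^+ i = 2 - 2 * 2^-1 ^+ N :> R.
  elim: N => [|N IH]; first by rewrite big_geq // expr0; lra.
  by rewrite big_nat_recr //= IH exprS; field.
by rewrite lerBlDr lerDl mulr_ge0 // exprn_ge0 // invr_ge0.
Qed.

Lemma csum_le (u : nat -> C) (B : R) :
  (forall n, cmod (u n) <= B * 2^-1 ^+ n) -> cmod (csum u) <= 2 * B.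
Proof.
move=> hu; rewrite -[csum u]subr0; apply: csum_closed; first by exists B.
have B0 : 0 <= B by have := hu 0%N; rewrite expr0 mulr1; apply: le_trans; exact: cmod_ge0.
apply: nearW => N; rewrite subr0 (le_trans (cmod_sum _ _)) //.
rewrite (le_trans (ler_sum _ (fun i _ => hu i))) // -mulr_sumr mulrC.
by rewrite ler_wpM2r // sum_half_le.
Qed.

Lemma derivable_quadratic (F : C -> C) (z L : C) (K eta : R) : 0 < eta ->
  (forall h : C, cmod h <= eta ->
     cmod (F (z + h) - F z - h * L) <= K * cmod h ^+ 2) ->
  derivable (F : C^o -> C^o) (z : C^o) (1 : C^o).
Proof.
move=> eta0 hF; apply/cvg_ex; exists L => /=.
apply/cvgrPdist_le => /= e; rewrite ltcE /= => /andP[/eqP e1 e0].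
pose d := Num.min eta (complex.Re e / (`|K| + 1)).
have K1 : 0 < `|K| + 1 by rewrite ltr_wpDl.
have d0 : 0 < d by rewrite lt_min eta0 divr_gt0.
have F1 : \forall h \near ((0 : C^o)^'), h != 0 by exact: nbhs_dnbhs_neq.
have F2 : \forall h \near ((0 : C^o)^'), `|h| < Complex d 0.
  by apply: dnbhs0_lt; rewrite ltcE /= eqxx.
apply: filterS2 F1 F2 => h h0.
rewrite cmod_norm ltcE /= => /andP[_ hd].
have -> : h *: (1 : C^o) = h by rewrite /GRing.scale /= mulr1.
rewrite cmod_norm lecE /= e1 eqxx /=.
have hE : cmod (F (z + h) - F z - h * L) <= K * cmod h ^+ 2.
  by apply: hF; rewrite (le_trans (ltW hd)) // ge_min lexx.
have -> : L - h^-1 *: (F (h + z) - F z) = - (h^-1 * (F (z + h) - F z - h * L)).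
  rewrite (_ : h^-1 *: _ = h^-1 * (F (h + z) - F z)) //.
  by rewrite [h + z]addrC [in RHS]mulrBr opprB mulrA mulVf // mul1r.
have ch0 : 0 < cmod h by rewrite lt0r cmod_eq0 h0 cmod_ge0.
rewrite cmodN cmodM cmodV mulrC ler_pdivrMr //.
apply: (le_trans hE); rewrite expr2 mulrA ler_wpM2r // ?(ltW ch0) //.
apply: (@le_trans _ _ ((`|K| + 1) * cmod h)).
  by rewrite ler_wpM2r ?(ltW ch0) // (le_trans (ler_norm _)) // lerDl.
rewrite mulrC -ler_pdivlMr //; apply: (le_trans (ltW hd)).
by rewrite ge_min lexx orbT.
Qed.

Lemma geometric_bound_real (K : nat -> R) : (forall n, 0 <= K n) ->
  geometric_bound (fun n => Complex (K n) 0) ->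
  exists B, forall n, K n <= B * 2^-1 ^+ n.
Proof.
move=> K0 [B hB]; exists B => n.
by have := hB n; rewrite cmod_real ger0_norm.
Qed.

(** A series of functions with a uniform second-order Taylor estimate may be
    differentiated term by term: the remainders add up to a remainder of the
    same kind. *)
Lemma derivable_csum (F : nat -> C -> C) (L : nat -> C) (K : nat -> R) (z : C)
    (eta : R) : 0 < eta -> (forall n, 0 <= K n) ->
  geometric_bound (fun n => Complex (K n) 0) ->
  (forall h : C, cmod h <= eta -> geometric_bound (fun n => F n (z + h))) ->
  (forall n (h : C), cmod h <= eta ->
     cmod (F n (z + h) - F n z - h * L n) <= K n * cmod h ^+ 2) ->
  derivable ((fun x => csum (F ^~ x)) : C^o -> C^o) (z : C^o) (1 : C^o).
Proof.
move=> eta0 K0 gK gF hF; have [B hB] := geometric_bound_real K0 gK.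
have gE h : cmod h <= eta -> geometric_bound (fun n => F n (z + h) - F n z - h * L n).
  move=> hh; exists (B * cmod h ^+ 2) => n.
  by rewrite (le_trans (hF _ _ hh)) // mulrAC ler_wpM2r // ?exprn_ge0 ?cmod_ge0.
have g0 : geometric_bound (F ^~ z).
  by have := gF 0; rewrite cmod0 addr0; apply; rewrite ltW.
have gB h : cmod h <= eta -> geometric_bound (fun n => F n (z + h) - F n z).
  move=> hh; have [B1 h1] := geometric_boundD (geometric_boundM (-1) g0) (gF h hh).
  by exists B1 => n; have := h1 n; rewrite mulN1r addrC.
pose e : C := Complex eta 0.
have e0 : e != 0 by rewrite -cmod_eq0 cmod_real gtr0_norm // gt_eqF.
have ee : cmod e <= eta by rewrite cmod_real gtr0_norm.
(* the derivatives are controlled by evaluating the estimate at one increment *)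
have gL : geometric_bound L.
  have [B1 h1] := geometric_boundM e^-1 (geometric_boundD
    (geometric_boundM (-1) (gE e ee)) (gB e ee)).
  exists B1 => n; have := h1 n.
  rewrite mulN1r opprB [X in _ * X](_ : _ = e * L n); last by ring.
  by rewrite mulrA mulVf // mul1r.
apply: (@derivable_quadratic _ _ (csum L) (2 * B) eta) => // h hh.
have gZ := geometric_boundM (- h) gL.
have -> : csum (fun n => F n (z + h)) - csum (F ^~ z) - h * csum L =
    csum (fun n => F n (z + h) - F n z - h * L n).
  rewrite -[RHS](_ : csum (fun n => - h * L n + (-1 * F n z + F n (z + h))) = _); last first.
    by congr csum; apply/funext => n; ring.
  rewrite !csum_lin //; [by ring|exact: gF|].
  by apply: geometric_boundD (gF h hh); apply: geometric_boundM.
rewrite -mulrA; apply: csum_le => n.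
by rewrite (le_trans (hF _ _ hh)) // mulrAC ler_wpM2r // ?exprn_ge0 ?cmod_ge0.
Qed.

(** By induction on q, multiplying the remainder of order q by (w + h)^-1. *)
Lemma inv_pow_taylor (w h : C) (m : R) (q : nat) : 0 < m ->
  m <= cmod w -> m <= cmod (w + h) ->
  cmod ((w + h) ^- q - w ^- q + q%:R * h * w ^- q.+1) <=
    (q * q.+1)%:R * m ^- q.+2 * cmod h ^+ 2.
Proof.
move=> m0 mw mwh.
have w0 : w != 0 by rewrite -cmod_eq0 gt_eqF // (lt_le_trans m0).
have wh0 : w + h != 0 by rewrite -cmod_eq0 gt_eqF // (lt_le_trans m0).
have ch0 : 0 <= cmod h ^+ 2 by rewrite exprn_ge0 ?cmod_ge0.
elim: q => [|q IH].
  by rewrite !expr0 invr1 subrr !mul0r addr0 cmod0 lexx.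
have -> : (w + h) ^- q.+1 - w ^- q.+1 + q.+1%:R * h * w ^- q.+2 =
   (w + h)^-1 * ((w + h) ^- q - w ^- q + q%:R * h * w ^- q.+1) +
   q.+1%:R * (h ^+ 2 * w ^- q.+2 * (w + h)^-1).
  rewrite -natr1 !exprS !invfM; set A := (w + h) ^- q; set B := w ^- q.
  by field; rewrite w0 wh0.
rewrite (le_trans (cmodD _ _)) // !cmodM !cmodV !cmodX cmod_natr.
have iw : (cmod (w + h))^-1 <= m^-1 by rewrite lef_pV2 // posrE // (lt_le_trans m0).
have iv : (cmod w ^+ q.+2)^-1 <= m ^- q.+2.
  rewrite lef_pV2 ?posrE ?exprn_gt0 ?(lt_le_trans m0) //.
  by rewrite lerXn2r // nnegrE ?(ltW m0) ?cmod_ge0.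
have p0 : 0 <= (cmod (w + h))^-1 by rewrite invr_ge0 cmod_ge0.
apply: (@le_trans _ _ (m^-1 * ((q * q.+1)%:R * m ^- q.+2 * cmod h ^+ 2) +
   q.+1%:R * (cmod h ^+ 2 * m ^- q.+2 * m^-1))).
  apply: lerD; first by apply: ler_pM => //; exact: cmod_ge0.
  rewrite ler_wpM2l //; apply: ler_pM => //.
    by rewrite mulr_ge0 // invr_ge0 exprn_ge0 ?cmod_ge0.
  by rewrite ler_wpM2l.
have e3 : m ^- q.+3 = m^-1 * m ^- q.+2 by rewrite exprS invfM.
have M0 : 0 <= m^-1 * m ^- q.+2 * cmod h ^+ 2.
  by apply: mulr_ge0 => //; rewrite -e3 invr_ge0 exprn_ge0 // ltW.
rewrite e3; move: M0; move: (m ^- q.+2) => M M0.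
rewrite [leLHS](_ : _ = (q * q.+1 + q.+1)%:R * (m^-1 * M * cmod h ^+ 2)); last first.
  by rewrite natrD natrM; ring.
rewrite [leRHS](_ : _ = (q.+1 * q.+2)%:R * (m^-1 * M * cmod h ^+ 2)); last by ring.
by rewrite ler_wpM2r // ler_nat; nia.
Qed.

End Holomorphy.

(** * Term-by-term integration *)

Section TermwiseIntegration.
Context {R : realType} d {T : measurableType d}.
Variable mu : {measure set T -> \bar R}.
Implicit Types (D : set T) (v : nat -> T -> R) (G : T -> R).

Lemma measurable_series D v G : measurable D ->
  (forall n, measurable_fun D (v n)) ->
  (forall n t, D t -> `|v n t| <= G t * 2^-1 ^+ n) ->
  measurable_fun D (fun t => limn (series (v ^~ t))).
Proof.
move=> mD mv hv.
apply: (measurable_fun_cvg (h := fun N t => series (v ^~ t) N)).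
  by move=> N; rewrite /series /=; exact: measurable_sum.
move=> t Dt; apply: (@is_cvg_series_half _ _ (G t)) => n; exact: hv.
Qed.

Lemma series_half_le (w : nat -> R) (B : R) :
  (forall n, `|w n| <= B * 2^-1 ^+ n) -> forall N, `|series w N| <= 2 * B.
Proof.
move=> hw N.
have B0 : 0 <= B by have := hw 0%N; rewrite expr0 mulr1; apply: le_trans.
rewrite /series /= (le_trans (ler_norm_sum _ _ _)) //.
rewrite (le_trans (ler_sum _ (fun i _ => hw i))) // -mulr_sumr mulrC.
by rewrite ler_wpM2r // sum_half_le.
Qed.

Lemma lim_series_half_le (w : nat -> R) (B : R) :
  (forall n, `|w n| <= B * 2^-1 ^+ n) -> `|limn (series w)| <= 2 * B.
Proof.
move=> hw; have cw := is_cvg_series_half hw.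
rewrite -(cvg_lim _ (cvg_norm cw)) //; apply: limr_le; first exact: is_cvg_norm.
by apply: nearW => N; exact: series_half_le.
Qed.

(** Dominated convergence: all partial sums stay below 2 G. *)
Lemma Rintegral_series D v G : measurable D ->
  (forall n, measurable_fun D (v n)) -> mu.-integrable D (EFin \o G) ->
  (forall n t, D t -> `|v n t| <= G t * 2^-1 ^+ n) ->
  \int[mu]_(t in D) limn (series (v ^~ t)) =
  limn (series (fun n => \int[mu]_(t in D) v n t)).
Proof.
move=> mD mv iG hv.
have G0 t : D t -> 0 <= G t.
  by move=> Dt; have := hv 0%N t Dt; rewrite expr0 mulr1; apply: le_trans.
have i2G : mu.-integrable D (EFin \o (fun t => 2 * G t)).
  have -> : EFin \o (fun t => 2 * G t) = (fun t => 2%:E * (EFin \o G) t)%E by [].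
  exact: integrableZl.
have iv n : mu.-integrable D (EFin \o v n).
  apply: le_integrable iG => //; first exact/measurable_EFinP/mv.
  move=> t Dt /=; rewrite lee_fin (le_trans (hv n t Dt)) // (ger0_norm (G0 t Dt)).
  by rewrite ler_piMr ?G0 // exprn_ile1 // ?invr_ge0 // invf_le1 ?ler1n.
have ml := measurable_series mD mv hv.
have il : mu.-integrable D (EFin \o (fun t => limn (series (v ^~ t)))).
  apply: le_integrable i2G => //; first exact/measurable_EFinP.
  move=> t Dt /=; rewrite lee_fin [leRHS]ger0_norm ?mulr_ge0 ?G0 //.
  by apply: lim_series_half_le => n; exact: hv.
have cv : (\int[mu]_(t in D) (series (v ^~ t) N)%:E @[N --> \oo] -->
          \int[mu]_(t in D) (limn (series (v ^~ t)))%:E)%E.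
  apply: (@dominated_cvg _ _ _ mu D mD _ _ (EFin \o (fun t => 2 * G t))) => //.
  - move=> N; apply/measurable_EFinP; rewrite /series /=.
    exact: measurable_sum.
  - move=> t Dt; apply: cvg_EFin; first exact: nearW.
    by apply: (@is_cvg_series_half _ _ (G t)) => n; exact: hv.
  - move=> N t Dt /=; rewrite lee_fin.
    by apply: series_half_le => n; exact: hv.
have E N : (\int[mu]_(t in D) ((series (v ^~ t) N)%:E))%E =
    (series (fun n => \int[mu]_(t in D) v n t) N)%:E.
  rewrite /series /=; under eq_integral do rewrite -sumEFin.
  rewrite integral_sum // -sumEFin; apply: eq_bigr => i _.
  by rewrite fineK //; exact: (integrable_fin_num mD (iv i)).
symmetry; apply/cvg_lim => //; move: cv; under eq_fun do rewrite E.
rewrite -[X in _ --> X]fineK; last exact: (integrable_fin_num mD il).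
by move/fine_cvg.
Qed.

End TermwiseIntegration.

(** * The fundamental theorem of calculus *)

Section Calculus.
Context {R : realType}.
Local Notation C := (complex R).
Local Notation mu := (@lebesgue_measure R).

Lemma continuous_is_derive (F f : R -> R) :
  (forall t : R, is_derive t 1 F (f t)) -> continuous F.
Proof.
move=> dF t; apply: differentiable_continuous.
by apply/derivable1_diffP; have := dF t => ?; exact: ex_derive.
Qed.

Lemma is_derive_FTC (F f : R -> R) (T : R) : 0 <= T ->
  (forall t : R, is_derive t 1 F (f t)) -> continuous f ->
  \int[mu]_(t in `[0, T]) f t = F T - F 0.
Proof.
rewrite le_eqVlt => /predU1P[<- _ _|T0 dF cf].
  by rewrite set_itv1 Rintegral_set1 subrr.
have cF := continuous_is_derive dF.
rewrite /Rintegral (@continuous_FTC2 _ _ F) //.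
- by apply: continuous_subspaceT.
- split.
  + by move=> t _; apply: ex_derive.
  + exact/cvg_at_right_filter/cF.
  + exact/cvg_at_left_filter/cF.
- by move=> t _; rewrite derive1E; exact: derive_val.
Qed.

(** The integrals over [0, n] tend to the integral over the half-line by
    dominated convergence. *)
Lemma is_derive_FTCy (F f : R -> R) (l : R) :
  (forall t : R, is_derive t 1 F (f t)) -> continuous f ->
  mu.-integrable Rplus (EFin \o f) -> F x @[x --> +oo] --> l ->
  \int[mu]_(t in Rplus) f t = l - F 0.
Proof.
move=> dF cf If Fl.
have mR : measurable (Rplus : set R) by exact: measurable_itv.
have cv : (\int[mu]_(t in Rplus) ((f \_ `[0%R, n%:R]) t)%:E @[n --> \oo] -->
          \int[mu]_(t in Rplus) (f t)%:E)%E.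
  apply: (@dominated_cvg _ _ _ mu Rplus mR _ _ (fun t => `|(f t)%:E|)%E).
  - move=> n; apply/measurable_EFinP; apply/(measurable_restrict f _ mR).
      exact: measurable_itv.
    by apply: measurable_funTS; exact: continuous_measurable_fun.
  - move=> t; rewrite /Rplus /= in_itv /= andbT => t0.
    apply: cvg_EFin; first exact: nearW.
    apply: cvg_near_cst; near=> n.
    rewrite /= patchE mem_set //= in_itv /= t0 /=.
    by near: n; exact: nbhs_infty_ger.
  - by [].
  - exact: integrable_abse.
  - move=> n t _ /=; rewrite lee_fin patchE; case: ifP => // _.
    by rewrite normr0.
have E n : (\int[mu]_(t in Rplus) ((f \_ `[0%R, n%:R]) t)%:E = (F n%:R - F 0)%:E)%E.
  rewrite -(is_derive_FTC (ler0n _ n) dF cf).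
  transitivity (\int[mu]_(t in Rplus) (((EFin \o f) \_ `[0%R, n%:R]) t))%E.
    by apply: eq_integral => t _; rewrite restrict_EFin.
  rewrite -integral_mkcondr.
  rewrite (_ : Rplus `&` _ = `[0, n%:R]%classic); last first.
    apply/seteqP; split => t /=; rewrite /Rplus /= !in_itv /=; first by case.
    by move=> /andP[t0 tn]; rewrite t0 tn.
  rewrite fineK //; apply: integrable_fin_num; first exact: measurable_itv.
  apply: continuous_compact_integrable; first exact: segment_compact.
  exact: continuous_subspaceT.
move: cv; under eq_fun do rewrite E.
rewrite -[X in _ --> X]fineK; last by apply: integrable_fin_num; [exact: mR|exact: If].
move/fine_cvg => cv.
apply: (cvg_unique _ cv) => //.
apply: cvgB; last exact: cvg_cst.
by apply: (cvg_comp _ _ (@cvgr_idn R) Fl).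
Unshelve. all: by end_near. Qed.

End Calculus.

(** * Integration of complex-valued functions *)

Section ComplexIntegral.
Context {R : realType}.
Local Notation C := (complex R).
Local Notation mu := (@lebesgue_measure R).
Implicit Types (g G : R -> C) (D : set R).

Definition cintegrable D g :=
  mu.-integrable D (EFin \o (fun t => complex.Re (g t))) /\
  mu.-integrable D (EFin \o (fun t => complex.Im (g t))).

Definition ccontinuous g :=
  continuous (fun t => complex.Re (g t)) /\
  continuous (fun t => complex.Im (g t)).

Definition is_cderive G g := forall t : R,
  is_derive t 1 (fun t => complex.Re (G t)) (complex.Re (g t)) /\
  is_derive t 1 (fun t => complex.Im (G t)) (complex.Im (g t)).

Lemma is_cderive_continuous G g : is_cderive G g -> ccontinuous G.
Proof.
move=> dG; split.
  by apply: (@continuous_is_derive _ _ (fun t => complex.Re (g t))) => t; have [] := dG t.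
by apply: (@continuous_is_derive _ _ (fun t => complex.Im (g t))) => t; have [] := dG t.
Qed.

Lemma ccontinuousD g h : ccontinuous g -> ccontinuous h ->
  ccontinuous (fun t => g t + h t).
Proof.
case=> gR gI [hR hI]; split => t.
  under eq_fun do rewrite ReD; apply: cvgD; [exact: gR|exact: hR].
under eq_fun do rewrite ImD; apply: cvgD; [exact: gI|exact: hI].
Qed.

Lemma ccontinuousZ (a : C) g : ccontinuous g -> ccontinuous (fun t => a * g t).
Proof.
case=> gR gI; split => t.
  under eq_fun do rewrite ReM.
  by apply: cvgB; apply: cvgMr; [exact: gR|exact: gI].
under eq_fun do rewrite ImM.
by apply: cvgD; apply: cvgMr; [exact: gI|exact: gR].
Qed.

Lemma cintegrableD D g h : measurable (D : set (measurableTypeR R)) ->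
  cintegrable D g -> cintegrable D h ->
  cintegrable D (fun t => g t + h t).
Proof.
move=> mD [gR gI] [hR hI]; split.
  have := integrableD mD gR hR; congr (integrable _ _ _).
  by apply/funext => t /=; rewrite ReD EFinD.
have := integrableD mD gI hI; congr (integrable _ _ _).
by apply/funext => t /=; rewrite ImD EFinD.
Qed.

Lemma cintegrableZ D (a : C) g : measurable (D : set (measurableTypeR R)) ->
  cintegrable D g ->
  cintegrable D (fun t => a * g t).
Proof.
move=> mD [gR gI].
have Z (b : R) h : mu.-integrable D (EFin \o h) ->
    mu.-integrable D (EFin \o (fun t => b * h t)) by exact: integrableZl.
split.
  have := integrableB mD (Z (complex.Re a) _ gR) (Z (complex.Im a) _ gI).
  by congr (integrable _ _ _); apply/funext => t /=; rewrite ReM EFinB.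
have := integrableD mD (Z (complex.Re a) _ gI) (Z (complex.Im a) _ gR).
by congr (integrable _ _ _); apply/funext => t /=; rewrite ImM EFinD.
Qed.

Lemma cintegralD D g h : measurable (D : set (measurableTypeR R)) ->
  cintegrable D g -> cintegrable D h ->
  cintegral D (fun t => g t + h t) = cintegral D g + cintegral D h.
Proof.
move=> mD [gR gI] [hR hI]; apply: complex_ext; rewrite ?ReD ?ImD /=.
  by under eq_Rintegral do rewrite ReD; rewrite RintegralD.
by under eq_Rintegral do rewrite ImD; rewrite RintegralD.
Qed.

Lemma cintegralZ D (a : C) g : measurable (D : set (measurableTypeR R)) ->
  cintegrable D g ->
  cintegral D (fun t => a * g t) = a * cintegral D g.
Proof.
move=> mD [gR gI].
have Z (b : R) h : mu.-integrable D (EFin \o h) ->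
    mu.-integrable D (EFin \o (fun t => b * h t)) by exact: integrableZl.
apply: complex_ext; rewrite ?ReM ?ImM /=.
  under eq_Rintegral do rewrite ReM; rewrite RintegralB //; [|exact: Z|exact: Z].
  by rewrite !RintegralZl.
under eq_Rintegral do rewrite ImM; rewrite RintegralD //; [|exact: Z|exact: Z].
by rewrite !RintegralZl.
Qed.

Lemma cintegral_FTC G g (T : R) : 0 <= T -> is_cderive G g -> ccontinuous g ->
  cintegral `[0, T] g = G T - G 0.
Proof.
move=> T0 dG [cR cI]; apply: complex_ext; rewrite ?ReD ?ImD ?ReN ?ImN /=.
  by apply: (is_derive_FTC (F := fun t => complex.Re (G t)) T0 _ cR) => t; have [] := dG t.
by apply: (is_derive_FTC (F := fun t => complex.Im (G t)) T0 _ cI) => t; have [] := dG t.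
Qed.

Lemma cintegral_FTCy G g : is_cderive G g -> ccontinuous g ->
  cintegrable Rplus g -> cmod (G t) @[t --> +oo] --> (0 : R) ->
  cintegral Rplus g = - G 0.
Proof.
move=> dG [cR cI] [iR iI] G0.
have lim0 (h : R -> R) : (forall t, `|h t| <= cmod (G t)) -> h t @[t --> +oo] --> (0 : R).
  move=> hG; apply/norm_cvg0P.
  apply: (squeeze_cvgr _ _ G0); last exact: cvg_cst.
  by apply: nearW => t; rewrite normr_ge0 hG.
apply: complex_ext; rewrite ?ReN ?ImN /=.
  rewrite (is_derive_FTCy _ cR iR (lim0 _ (fun t => le_Re_cmod (G t)))) ?sub0r // => t.
  by have [] := dG t.
rewrite (is_derive_FTCy _ cI iI (lim0 _ (fun t => le_Im_cmod (G t)))) ?sub0r // => t.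
by have [] := dG t.
Qed.

Lemma Rplus_ge0 (t : R) : Rplus t -> 0 <= t.
Proof. by rewrite /Rplus /= in_itv /= andbT. Qed.

Lemma measurable_Rplus : measurable (Rplus : set (measurableTypeR R)).
Proof. exact: measurable_itv. Qed.

Lemma eq_cintegral (D : set R) (u v : R -> C) : (forall t, D t -> u t = v t) ->
  cintegral D u = cintegral D v.
Proof.
move=> uv; congr Complex; apply: eq_Rintegral => t; rewrite inE => Dt;
  by rewrite uv.
Qed.

Lemma ccontinuous_measurable (g : R -> C) : ccontinuous g ->
  measurable_fun (Rplus : set (measurableTypeR R))
    (fun t => complex.Re (g t) : measurableTypeR R) /\
  measurable_fun (Rplus : set (measurableTypeR R))
    (fun t => complex.Im (g t) : measurableTypeR R).
Proof.
by move=> [gR gI]; split; apply: measurable_funTS; exact: continuous_measurable_fun.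
Qed.

Lemma measurable_cmod (D : set (measurableTypeR R)) (g : R -> C) :
  measurable_fun D (fun t => complex.Re (g t) : measurableTypeR R) ->
  measurable_fun D (fun t => complex.Im (g t) : measurableTypeR R) ->
  measurable_fun D (fun t => cmod (g t) : measurableTypeR R).
Proof.
move=> mRe mIm.
rewrite (_ : (fun t => _) =
  (fun t => (complex.Re (g t) ^+ 2 + complex.Im (g t) ^+ 2) `^ 2^-1)).
  apply: (measurableT_comp (measurable_powR 2^-1)).
  by apply: measurable_funD; apply: measurable_funX.
by apply/funext => t; rewrite cmodE powR12_sqrt // addr_ge0 ?sqr_ge0.
Qed.

Lemma measurable_csum (u : nat -> R -> C) (B : R) :
  (forall n, ccontinuous (u n)) ->
  (forall n t, 0 <= t -> cmod (u n t) <= B * 2^-1 ^+ n) ->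
  measurable_fun (Rplus : set (measurableTypeR R))
    (fun t => complex.Re (csum (u ^~ t)) : measurableTypeR R) /\
  measurable_fun (Rplus : set (measurableTypeR R))
    (fun t => complex.Im (csum (u ^~ t)) : measurableTypeR R).
Proof.
move=> cu hu; split; apply: (@measurable_series _ _ _ _ _ (fun=> B)) => //.
- exact: measurable_Rplus.
- by move=> n; have [] := ccontinuous_measurable (cu n).
- by move=> n t /Rplus_ge0 t0; rewrite (le_trans (le_Re_cmod _)) ?hu.
- exact: measurable_Rplus.
- by move=> n; have [] := ccontinuous_measurable (cu n).
- by move=> n t /Rplus_ge0 t0; rewrite (le_trans (le_Im_cmod _)) ?hu.
Qed.

Lemma cintegral_csum D (u : nat -> R -> C) (G : R -> R) :
  measurable (D : set (measurableTypeR R)) ->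
  (forall n, measurable_fun D (fun t => complex.Re (u n t))) ->
  (forall n, measurable_fun D (fun t => complex.Im (u n t))) ->
  mu.-integrable D (EFin \o G) ->
  (forall n t, D t -> cmod (u n t) <= G t * 2^-1 ^+ n) ->
  cintegral D (fun t => csum (u ^~ t)) = csum (fun n => cintegral D (u n)).
Proof.
move=> mD mR mI iG hu; apply: complex_ext => /=.
  apply: (Rintegral_series mD mR iG) => n t Dt.
  by rewrite (le_trans (le_Re_cmod _)) // hu.
apply: (Rintegral_series mD mI iG) => n t Dt.
by rewrite (le_trans (le_Im_cmod _)) // hu.
Qed.

(** The kernel t^j e^(-m t), whose Laplace transform is j! / (z + m)^(j+1). *)
Definition gexp (j : nat) (m : C) (t : R) : C :=
  Complex (t ^+ j) 0 * cexp (- (m * Complex t 0)).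

Definition dgexp (j : nat) (m : C) (t : R) : C :=
  j%:R * gexp j.-1 m t - m * gexp j m t.

Lemma gexpE j m t : gexp j m t =
  Complex (t ^+ j * (expR (- (complex.Re m * t)) * cos (complex.Im m * t)))
          (- (t ^+ j * (expR (- (complex.Re m * t)) * sin (complex.Im m * t)))).
Proof.
have e : - (m * Complex t 0) =
    Complex (- (complex.Re m * t)) (- (complex.Im m * t)) :> C.
  apply: complex_ext; rewrite ?ReN ?ImN ?ReM ?ImM /=; ring.
apply: complex_ext; rewrite /gexp e ?ReM ?ImM /= cosN ?sinN; ring.
Qed.

Lemma is_derive_linear (f df : R -> R) (a t : R) :
  (forall s : R, is_derive s 1 f (df s)) ->
  is_derive t 1 (fun t => f (a * t)) (a * df (a * t)).
Proof.
move=> hf; have da : is_derive t 1 (fun t => a * t) a.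
  apply: (is_derive_eq (is_deriveZ a (is_derive_id t 1))).
  by rewrite /GRing.scale /= mulr1.
rewrite mulrC; exact: (@is_derive1_comp _ f (fun t => a * t)).
Qed.

Lemma is_derive_expRN (c t : R) :
  is_derive t 1 (fun t => expR (- (c * t))) (- c * expR (- (c * t))).
Proof.
have E s : expR (- (c * s)) = expR (- c * s) by rewrite mulNr.
rewrite E (_ : (fun s => _) = fun s => expR (- c * s)); last exact/funext.
exact: (@is_derive_linear expR expR (- c) t (@is_derive_expR R)).
Qed.

Lemma is_derive_damped (f df : R -> R) (j : nat) (x t : R) :
  is_derive t 1 f (df t) ->
  is_derive t 1 (fun t => t ^+ j * (expR (- (x * t)) * f t))
    (j%:R * t ^+ j.-1 * (expR (- (x * t)) * f t) +
     t ^+ j * (expR (- (x * t)) * (df t - x * f t))).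
Proof.
move=> hf.
have dX : is_derive t 1 (fun t => t ^+ j) (j%:R * t ^+ j.-1).
  rewrite (_ : (fun t : R => t ^+ j) = (id : R -> R) ^+ j); last first.
    by apply/funext => s; rewrite exprfctE.
  apply: (is_derive_eq (is_deriveX j (is_derive_id t 1))).
  by rewrite /GRing.scale /= mulr1.
have dE := is_derive_expRN x t.
apply: (is_derive_eq (is_deriveM dX (is_deriveM dE hf))).
by rewrite /GRing.scale /= mulrfctE; ring.
Qed.

Lemma is_cderive_gexp j m : is_cderive (gexp j m) (dgexp j m).
Proof.
move=> t; rewrite /dgexp complex_natr !gexpE ReD ImD ReN ImN !ReM !ImM /=.
set x := complex.Re m; set y := complex.Im m.
have dC : is_derive t 1 (fun t => cos (y * t)) (y * - sin (y * t)).
  exact: (@is_derive_linear cos (fun s => - sin s)).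
have dS : is_derive t 1 (fun t => sin (y * t)) (y * cos (y * t)).
  exact: (@is_derive_linear sin cos).
split.
  rewrite (_ : (fun t => complex.Re (gexp j m t)) = fun t =>
    t ^+ j * (expR (- (x * t)) * cos (y * t))); last first.
    by apply/funext => s; rewrite gexpE.
  apply: (is_derive_eq
    (is_derive_damped (df := fun t => y * - sin (y * t)) j x dC)).
  by rewrite /=; ring.
rewrite (_ : (fun t => complex.Im (gexp j m t)) = - fun t =>
    t ^+ j * (expR (- (x * t)) * sin (y * t))); last first.
  by apply/funext => s; rewrite gexpE.
apply: (is_derive_eq
  (is_deriveN (is_derive_damped (df := fun t => y * cos (y * t)) j x dS))).
by ring.
Qed.

Lemma ccontinuous_gexp j m : ccontinuous (gexp j m).
Proof. exact: is_cderive_continuous (is_cderive_gexp j m). Qed.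

Lemma ccontinuous_dgexp j m : ccontinuous (dgexp j m).
Proof.
rewrite /dgexp; apply: ccontinuousD; first exact/ccontinuousZ/ccontinuous_gexp.
under eq_fun do rewrite -mulNr.
exact/ccontinuousZ/ccontinuous_gexp.
Qed.

Lemma cmod_gexp j m t : 0 <= t ->
  cmod (gexp j m t) = t ^+ j * expR (- (complex.Re m * t)).
Proof.
move=> t0; rewrite cmodM cmod_real cmod_cexp ger0_norm ?exprn_ge0 //.
by rewrite ReN ReM /= mulr0 subr0.
Qed.

End ComplexIntegral.

(** * The Laplace transform of a power times an exponential *)

Section LaplaceKernel.
Context {R : realType}.
Local Notation C := (complex R).
Local Notation mu := (@lebesgue_measure R).

Lemma cvgy_expRN (c : R) : 0 < c -> expR (- (c * t)) @[t --> +oo] --> (0 : R).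
Proof.
move=> c0; have h : (c * t) @[t --> +oo] --> +oo.
  by apply: gt0_cvgMry => //; exact: cvg_id.
exact: (cvg_comp _ _ h (@cvgr_expR R)).
Qed.

Lemma integrable_expRN (c : R) : 0 < c ->
  mu.-integrable Rplus (EFin \o (fun t => expR (- (c * t)))).
Proof.
move=> c0.
pose F (t : R) := - c^-1 * expR (- (c * t)).
have dF (t : R) : is_derive t 1 F (expR (- (c * t))).
  apply: (is_derive_eq (is_deriveZ (- c^-1) (is_derive_expRN c t))).
  by rewrite /GRing.scale /= mulrA mulrNN mulVf ?mul1r // gt_eqF.
have cF := continuous_is_derive dF.
have cE := continuous_is_derive (@is_derive_expRN R c).
apply/integrableP; split.
  by apply/measurable_EFinP; apply: measurable_funTS; exact: continuous_measurable_fun.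
under eq_integral do rewrite /= ger0_norm ?expR_ge0 //.
rewrite (@ge0_continuous_FTC2y _ _ F 0 0) ?ltry //.
- exact: continuous_subspaceT.
- rewrite -(mulr0 (- c^-1)); apply: cvgMr; exact: cvgy_expRN.
- exact/cvg_at_right_filter/cF.
- by move=> t _; rewrite derive1E; exact: derive_val.
Qed.

Lemma pow_le_expR (j : nat) (y : R) : 0 <= y -> y ^+ j <= j`!%:R * expR y.
Proof.
move=> y0; case: j => [|j].
  by rewrite expr0 mul1r -expR0 ler_expR.
have f0 : 0 < (j.+1)`!%:R :> R by rewrite ltr0n fact_gt0.
rewrite -ler_pdivrMl // mulrC (le_trans _ (expR_ge1Dxn j y0)) //.
by rewrite lerDr.
Qed.

(** Half of the exponential decay pays for the power. *)
Lemma pow_expRN_le (j : nat) (x t : R) : 0 < x -> 0 <= t ->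
  t ^+ j * expR (- (x * t)) <=
  (j`!%:R * (2 / x) ^+ j) * expR (- (x / 2 * t)).
Proof.
move=> x0 t0; have y0 : 0 <= x / 2 * t by rewrite !mulr_ge0 // ltW.
have -> : expR (- (x * t)) = expR (- (x / 2 * t)) * expR (- (x / 2 * t)).
  by rewrite -expRD; congr expR; field.
rewrite mulrA ler_wpM2r ?expR_ge0 // expRN ler_pdivrMr ?expR_gt0 //.
have -> : t ^+ j = (2 / x) ^+ j * (x / 2 * t) ^+ j.
  by rewrite -exprMn; congr (_ ^+ _); field; rewrite gt_eqF.
rewrite [_`!%:R * _]mulrC -[leRHS]mulrA ler_wpM2l ?pow_le_expR //.
by rewrite exprn_ge0 // divr_ge0 // ltW.
Qed.

Lemma cintegrable_dominated (g : R -> C) (G : R -> R) : ccontinuous g ->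
  mu.-integrable Rplus (EFin \o G) ->
  (forall t, 0 <= t -> cmod (g t) <= G t) -> cintegrable Rplus g.
Proof.
move=> [gR gI] iG hg.
have mR := measurable_Rplus.
have dom (h : R -> R) : continuous h -> (forall t, `|h t| <= cmod (g t)) ->
    mu.-integrable Rplus (EFin \o h).
  move=> ch hh; apply: le_integrable iG => //.
    by apply/measurable_EFinP; apply: measurable_funTS; exact: continuous_measurable_fun.
  move=> t; rewrite /Rplus /= in_itv /= andbT => t0; rewrite lee_fin.
  by rewrite (le_trans (hh t)) // (le_trans (hg t t0)) // ler_norm.
by split; apply: dom => // t; [exact: le_Re_cmod|exact: le_Im_cmod].
Qed.

Lemma cintegrable_gexp (j : nat) (m : C) : 0 < complex.Re m ->
  cintegrable Rplus (gexp j m).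
Proof.
move=> m0; have x2 : 0 < complex.Re m / 2 by rewrite divr_gt0.
pose K := j`!%:R * (2 / complex.Re m) ^+ j.
apply: (@cintegrable_dominated _ (fun t => K * expR (- (complex.Re m / 2 * t)))).
- exact: ccontinuous_gexp.
- exact: (integrableZl measurable_Rplus K (integrable_expRN x2)).
- by move=> t t0; rewrite cmod_gexp // pow_expRN_le.
Qed.

Lemma cvgy_cmod_gexp (j : nat) (m : C) : 0 < complex.Re m ->
  cmod (gexp j m t) @[t --> +oo] --> (0 : R).
Proof.
move=> m0; have x2 : 0 < complex.Re m / 2 by rewrite divr_gt0.
pose K := j`!%:R * (2 / complex.Re m) ^+ j.
have h : K * expR (- (complex.Re m / 2 * t)) @[t --> +oo] --> (0 : R).
  by rewrite -(mulr0 K); apply: cvgMr; exact: cvgy_expRN.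
apply: (squeeze_cvgr _ _ h); last exact: cvg_cst.
near=> t; rewrite cmod_ge0 /= cmod_gexp; first exact: pow_expRN_le.
by near: t; apply: nbhs_pinfty_ge; rewrite num_real.
Unshelve. all: by end_near. Qed.

Lemma gexp0 (j : nat) (m : C) : gexp j m 0 = (j == 0%N)%:R.
Proof.
rewrite gexpE !mulr0 oppr0 expR0 cos0 sin0 !mulr0 oppr0 !mulr1 expr0n.
by case: j.
Qed.

Lemma cintegral_gexp (j : nat) (m : C) : 0 < complex.Re m ->
  cintegral Rplus (gexp j m) = j`!%:R / m ^+ j.+1.
Proof.
move=> m0; have mR := measurable_Rplus.
have mn0 : m != 0 by apply/eqP => m_eq; rewrite m_eq ltxx in m0.
(* integrating the derivative of t^j e^(-m t) gives the recursion *)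
have rec i : i%:R * cintegral Rplus (gexp i.-1 m) - m * cintegral Rplus (gexp i m) =
    - (i == 0%N)%:R.
  have i1 := cintegrable_gexp i.-1 m0; have i2 := cintegrable_gexp i m0.
  rewrite -(gexp0 i m) -(cintegral_FTCy (is_cderive_gexp i m)).
  - rewrite /dgexp -mulNr -!cintegralZ // -cintegralD //; try exact: cintegrableZ.
    by under [in LHS]eq_fun do rewrite mulNr.
  - exact: ccontinuous_dgexp.
  - rewrite /dgexp; under eq_fun do rewrite -mulNr.
    by apply: cintegrableD => //; exact: cintegrableZ.
  - exact: cvgy_cmod_gexp.
elim: j => [|j IH].
  have /eqP := rec 0%N; rewrite mul0r sub0r eqr_opp => /eqP e.
  by rewrite fact0 expr1 -e mulrC mulKf.
have := rec j.+1; rewrite /= oppr0 IH => /eqP; rewrite subr_eq0 => /eqP e.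
apply: (mulfI mn0); rewrite -e factS natrM !exprS; field.
by rewrite expf_neq0.
Qed.

End LaplaceKernel.

(** * The bump t^k e^(-t) and its majorant *)

Section Bump.
Context {R : realType}.
Local Notation C := (complex R).
Local Notation mu := (@lebesgue_measure R).

(** The constant that brings the maximum of t^k e^(-t), taken at t = k, to 1. *)
Definition bump_norm (k : nat) : R := (expR 1 / k%:R) ^+ k.

(** A majorant of the bump located at j.+1, with an explicit primitive and a width
    of the same order sqrt j. *)
Definition lorentz (j : nat) (t : R) : R :=
  (1 + j%:R * ((t / j.+1%:R - 1) ^+ 2 / 16))^-1.

Lemma bump_norm_gt0 k : 0 < bump_norm k.
Proof.
case: k => [|k]; first by rewrite /bump_norm expr0.
by rewrite exprn_gt0 // divr_gt0 ?expR_gt0.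
Qed.

(** From e^v = (e^(v/4))^4 and e^x >= 1 + x; the fourth power outgrows the cubic
    left-hand side. *)
Lemma expR_ge_quartic (v : R) : -1 <= v -> (1 + v) * (1 + v ^+ 2 / 16) <= expR v.
Proof.
move=> v1; have -> : expR v = expR (v / 4) ^+ 4.
  by rewrite -expRM_natl; congr expR; field.
have h4 : 0 <= 1 + v / 4 by lra.
have := lerXn2r 4 h4 (expR_ge0 (v / 4)) (expR_ge1Dx (v / 4)).
apply: le_trans; rewrite -subr_ge0.
have -> : (1 + v / 4) ^+ 4 - (1 + v) * (1 + v ^+ 2 / 16) =
    v ^+ 2 * (5 / 16) + v ^+ 4 / 256 by field.
by apply: addr_ge0; apply: mulr_ge0; rewrite ?exprn_even_ge0.
Qed.

Lemma bump_profile_le (tau : R) : 0 <= tau ->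
  tau * expR (1 - tau) <= (1 + (tau - 1) ^+ 2 / 16)^-1.
Proof.
move=> t0; have h : 0 < 1 + (tau - 1) ^+ 2 / 16 by rewrite ltr_wpDr // mulr_ge0 ?sqr_ge0.
have -> : 1 - tau = - (tau - 1) by ring.
rewrite -[leRHS]mul1r ler_pdivlMr // mulrAC expRN ler_pdivrMr ?expR_gt0 // mul1r.
have e : 1 + (tau - 1) = tau by ring.
by have := @expR_ge_quartic (tau - 1); rewrite e; apply; lra.
Qed.

(** In the variable t / k the bump is the k-th power of a fixed profile with
    maximum 1. *)
Lemma bumpE (k : nat) (t : R) :
  bump_norm k.+1 * (t ^+ k.+1 * expR (- t)) =
  (t / k.+1%:R * expR (1 - t / k.+1%:R)) ^+ k.+1.
Proof.
rewrite expRD !exprMn -expRM_natl.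
have -> : k.+1%:R * 1 = k.+1%:R :> R by rewrite mulr1.
have -> : expR (- (t / k.+1%:R)) ^+ k.+1 = expR (- t).
  by rewrite -expRM_natl; congr expR; field; rewrite nat1r pnatr_eq0.
have -> : expR k.+1%:R = expR 1 ^+ k.+1 :> R.
  by rewrite -[in LHS](mulr1 k.+1%:R) expRM_natl.
by rewrite /bump_norm exprMn; ring.
Qed.

Lemma bernoulli_ineq (x : R) (j : nat) : 0 <= x -> 1 + j%:R * x <= (1 + x) ^+ j.
Proof.
move=> x0; elim: j => [|j IH]; first by rewrite mul0r addr0 expr0.
rewrite exprS (le_trans _ (ler_wpM2l _ IH)) ?addr_ge0 // -natr1.
have : 0 <= j%:R * x ^+ 2 by rewrite mulr_ge0 ?sqr_ge0.
nra.
Qed.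

Lemma bump_profile_pow_le (tau : R) (j : nat) : 0 <= tau ->
  (tau * expR (1 - tau)) ^+ j <= (1 + j%:R * ((tau - 1) ^+ 2 / 16))^-1.
Proof.
move=> t0; have x0 : 0 <= (tau - 1) ^+ 2 / 16 by rewrite mulr_ge0 ?sqr_ge0.
have p0 : 0 <= tau * expR (1 - tau) by rewrite mulr_ge0 ?expR_ge0.
apply: le_trans (lerXn2r j p0 _ (bump_profile_le t0)) _.
  by rewrite nnegrE invr_ge0 addr_ge0.
rewrite exprVn lef_pV2 ?posrE ?bernoulli_ineq // ?exprn_gt0 // ltr_wpDr //.
by rewrite mulr_ge0.
Qed.

Lemma bump_profile_le1 (tau : R) : 0 <= tau -> tau * expR (1 - tau) <= 1.
Proof.
move=> t0; apply: le_trans (bump_profile_le t0) _.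
by rewrite invf_le1 ?lerDl ?ltr_wpDr // mulr_ge0 ?sqr_ge0.
Qed.

Lemma lorentz_denominator (j : nat) (t : R) :
  1 <= 1 + j%:R * ((t / j.+1%:R - 1) ^+ 2 / 16).
Proof. by rewrite lerDl mulr_ge0 // mulr_ge0 ?sqr_ge0. Qed.

Lemma lorentz_gt0 (j : nat) (t : R) : 0 < lorentz j t.
Proof. by rewrite invr_gt0 (lt_le_trans _ (lorentz_denominator j t)). Qed.

Lemma lorentz_le1 (j : nat) (t : R) : lorentz j t <= 1.
Proof.
by rewrite invf_le1 ?lorentz_denominator // (lt_le_trans _ (lorentz_denominator j t)).
Qed.

Lemma bump_le1 (j : nat) (t : R) : 0 <= t ->
  bump_norm j.+1 * (t ^+ j.+1 * expR (- t)) <= 1.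
Proof.
move=> t0; have h : 0 <= t / j.+1%:R by rewrite divr_ge0.
by rewrite bumpE exprn_ile1 ?bump_profile_le1 // mulr_ge0 ?expR_ge0.
Qed.

Lemma bump_le_lorentz (j : nat) (t : R) : 0 <= t ->
  bump_norm j.+1 * (t ^+ j.+1 * expR (- t)) <= lorentz j t.
Proof.
move=> t0; have h : 0 <= t / j.+1%:R by rewrite divr_ge0.
have p0 : 0 <= t / j.+1%:R * expR (1 - t / j.+1%:R) by rewrite mulr_ge0 ?expR_ge0.
rewrite bumpE exprS (le_trans _ (bump_profile_pow_le j h)) //.
by rewrite ler_piMl ?exprn_ge0 // bump_profile_le1.
Qed.

(** The factor k / t produced by differentiation uses up one factor of the
    profile; the factor e^(1 - t / k) that remains is at most e. *)
Lemma bump_deriv_le_lorentz (j : nat) (t : R) : 0 <= t ->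
  bump_norm j.+1 * (j.+1%:R * (t ^+ j * expR (- t))) <= expR 1 * lorentz j t.
Proof.
move=> t0; set tau := t / j.+1%:R; have h : 0 <= tau by rewrite divr_ge0.
have -> : bump_norm j.+1 * (j.+1%:R * (t ^+ j * expR (- t))) =
    expR (1 - tau) * (tau * expR (1 - tau)) ^+ j.
  have e1 : expR (1 - tau) ^+ j.+1 = expR 1 ^+ j.+1 * expR (- t).
    rewrite expRD exprMn; congr (_ * _).
    by rewrite -expRM_natl; congr expR; rewrite /tau; field; rewrite nat1r pnatr_eq0.
  rewrite exprMn [RHS]mulrCA -exprS e1 /bump_norm /tau !exprMn !exprVn !exprS.
  by field; rewrite nat1r pnatr_eq0 expf_neq0 // pnatr_eq0.
apply: ler_pM; rewrite ?expR_ge0 ?exprn_ge0 ?mulr_ge0 ?expR_ge0 //.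
  by rewrite ler_expR; lra.
exact: bump_profile_pow_le.
Qed.

(** With t / k = 1 + v, the profile (1 + v) e^(-v) is at least 1 - v^2 and
    Bernoulli's inequality applies; the interval is as long, up to a constant, as
    the bump is wide. *)
Lemma bump_ge (j : nat) (t : R) :
  j.+1%:R <= t <= j.+1%:R + Num.sqrt j.+1%:R / 2 ->
  3 / 4 <= bump_norm j.+1 * (t ^+ j.+1 * expR (- t)).
Proof.
move=> /andP[kt tk]; set K : R := j.+1%:R; have K0 : 0 < K by rewrite ltr0n.
have sK := sqr_sqrtr (ltW K0); have s0 : 0 < Num.sqrt K by rewrite sqrtr_gt0.
rewrite bumpE -/K; set v := t / K - 1.
have v0 : 0 <= v by rewrite subr_ge0 ler_pdivlMr // mul1r.
have v1 : K * v ^+ 2 <= 1 / 4.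
  have h : K * v <= Num.sqrt K / 2.
    by rewrite /v mulrBr mulr1 mulrCA divff ?mulr1 ?gt_eqF // lerBlDl.
  have : (K * v) ^+ 2 <= (Num.sqrt K / 2) ^+ 2.
    by rewrite lerXn2r // nnegrE ?mulr_ge0 // ?ltW.
  rewrite !exprMn sK exprVn => h2; rewrite -(ler_pM2l K0).
  rewrite mulrA -expr2; apply: (le_trans h2); lra.
have K1 : 1 <= K by rewrite ler1n.
have vsq : v ^+ 2 <= 1 / 4.
  by rewrite (le_trans _ v1) // ler_peMl // sqr_ge0.
have -> : t / K = 1 + v by rewrite /v; ring.
have -> : 1 - (1 + v) = - v by ring.
have hp : 1 - v ^+ 2 <= (1 + v) * expR (- v).
  rewrite (_ : 1 - v ^+ 2 = (1 + v) * (1 - v)); last by ring.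
  by rewrite ler_wpM2l ?expR_ge1Dx // addr_ge0.
have hq : 0 <= 1 - v ^+ 2 by lra.
have hB (i : nat) : 1 - i%:R * v ^+ 2 <= (1 - v ^+ 2) ^+ i.
  elim: i => [|i IH]; first by rewrite mul0r subr0 expr0.
  rewrite [_ ^+ i.+1]exprS (le_trans _ (ler_wpM2l hq IH)) // -natr1.
  have : 0 <= i%:R * (v ^+ 2) ^+ 2 by rewrite mulr_ge0 ?sqr_ge0.
  move: (v ^+ 2) => w; nra.
apply: le_trans (le_trans (hB j.+1) _); first by rewrite -/K; lra.
rewrite lerXn2r // nnegrE //; first by apply: le_trans hp.
Qed.

End Bump.

(** * The mass of the bump *)

Section BumpMass.
Context {R : realType}.
Local Notation C := (complex R).
Local Notation mu := (@lebesgue_measure R).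

Lemma lorentzE (j : nat) (t : R) :
  lorentz j t = (1 + (Num.sqrt j%:R / (4 * j.+1%:R) * (t - j.+1%:R)) ^+ 2)^-1.
Proof.
congr (_ ^-1); congr (1 + _).
rewrite !exprMn sqr_sqrtr // exprVn.
by field; rewrite nat1r pnatr_eq0.
Qed.

Lemma is_derive_scaled_atan (c b t : R) : c != 0 ->
  is_derive t 1 (fun t => c^-1 * atan (c * (t - b)))
    ((1 + (c * (t - b)) ^+ 2)^-1).
Proof.
move=> c0.
have d1 : is_derive t 1 (fun t => c * (t - b)) c.
  rewrite (_ : (fun t => c * (t - b)) = c \*: ((id : R -> R) - cst b)); last first.
    by apply/funext => s.
  apply: (is_derive_eq (is_deriveZ c (is_deriveB (is_derive_id t 1) (is_derive_cst b t 1)))).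
  by rewrite subr0 /GRing.scale /= mulr1.
have d2 := @is_derive1_comp _ atan (fun t => c * (t - b)) t _ _
  (is_derive1_atan (c * (t - b))) d1.
apply: (is_derive_eq (is_deriveZ c^-1 d2)).
by rewrite /GRing.scale /= mulrCA mulVf // mulr1.
Qed.

Lemma continuous_lorentz (j : nat) : continuous (@lorentz R j).
Proof.
move=> t; apply: cvgV.
  by rewrite gt_eqF // (lt_le_trans _ (lorentz_denominator j t)).
apply: cvgD; first exact: cvg_cst.
apply: cvgMr; apply: cvgMl.
under eq_fun do rewrite expr2; rewrite expr2.
by apply: cvgM; apply: cvgB; try exact: cvg_cst; apply: cvgMl; exact: cvg_id.
Qed.

Lemma integral_lorentz_le (j : nat) : (0 < j)%N ->
  (\int[mu]_(t in Rplus) (lorentz j t)%:E <=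
   (8 * pi * Num.sqrt j.+1%:R)%:E)%E.
Proof.
move=> j0; pose K : R := j.+1%:R; have K0 : 0 < K by rewrite ltr0n.
have J0 : 0 < j%:R :> R by rewrite ltr0n.
have sj : 0 < Num.sqrt (j%:R : R) by rewrite sqrtr_gt0.
pose c : R := Num.sqrt j%:R / (4 * K).
have c0 : 0 < c by rewrite divr_gt0 // mulr_gt0.
have dF t := @is_derive_scaled_atan c K t (lt0r_neq0 c0).
rewrite (@ge0_continuous_FTC2y _ _ (fun t => c^-1 * atan (c * (t - K))) 0 (c^-1 * (pi / 2))).
- rewrite -EFinB lee_fin -mulrBr.
  apply: (@le_trans _ _ (c^-1 * pi)).
    rewrite ler_wpM2l ?invr_ge0 ?(ltW c0) //.
    have := atan_gtNpi2 (c * (0 - K)); lra.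
  rewrite mulrAC ler_wpM2r ?pi_ge0 // /c invf_div ler_pdivrMr //.
  have aS : Num.sqrt K <= 2 * Num.sqrt j%:R.
    have -> : 2 = Num.sqrt (2 ^+ 2) :> R by rewrite sqrtr_sqr ger0_norm.
    by rewrite -sqrtrM ?exprn_ge0 // ler_wsqrtr // -natrX -natrM ler_nat; lia.
  have := ler_wpM2l (sqrtr_ge0 K) aS.
  rewrite -expr2 sqr_sqrtr ?(ltW K0) //; lra.
- by move=> t _; exact: ltW (lorentz_gt0 _ _).
- by apply: continuous_subspaceT; exact: continuous_lorentz.
- apply: cvgMr.
  have h : (c * (t - K)) @[t --> +oo] --> +oo.
    apply: gt0_cvgMry => //; apply/cvgryPge => A; near=> t.
    by rewrite lerBrDr; near: t; apply: nbhs_pinfty_ge; rewrite num_real.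
  exact: (cvg_comp _ _ h (@cvgy_atan R)).
- by move=> t _; have := dF t => ?; exact: ex_derive.
- by apply: cvg_at_right_filter; apply: (continuous_is_derive dF).
- by move=> t _; rewrite derive1E lorentzE; have := dF t => ?; exact: derive_val.
Unshelve. all: by end_near. Qed.

Lemma integrable_lorentz (j : nat) : (0 < j)%N ->
  mu.-integrable Rplus (EFin \o (@lorentz R j)).
Proof.
move=> j0; apply/integrableP; split.
  apply/measurable_EFinP; apply: measurable_funTS; apply: continuous_measurable_fun.
  exact: continuous_lorentz.
under eq_integral do rewrite /= ger0_norm ?(ltW (lorentz_gt0 _ _)) //.
exact: le_lt_trans (integral_lorentz_le j0) (ltry _).
Qed.

(** The factorial is the integral of t^k e^(-t), so the integral of the majorant
    takes the place of Stirling's formula. *)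
Lemma bump_mass (j : nat) : (0 < j)%N ->
  bump_norm j.+1 * (j.+1)`!%:R <= 8 * pi * Num.sqrt j.+1%:R :> R.
Proof.
move=> j0; have mR := @measurable_Rplus R.
have h := @cintegral_gexp R j.+1 1 ltr01; rewrite expr1n divr1 complex_natr in h.
have e : \int[mu]_(t in Rplus) complex.Re (gexp j.+1 (1 : C) t) = (j.+1)`!%:R.
  exact: (congr1 (@complex.Re R) h).
rewrite -e -RintegralZl //; last first.
  by have [] := @cintegrable_gexp R j.+1 1 ltr01.
have iZ : mu.-integrable Rplus
    (EFin \o (fun t => bump_norm j.+1 * complex.Re (gexp j.+1 (1 : C) t))).
  have [iR _] := @cintegrable_gexp R j.+1 1 ltr01.
  exact: (integrableZl mR (bump_norm j.+1) iR).
apply: (@le_trans _ _ (\int[mu]_(t in Rplus) lorentz j t)).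
  apply: le_Rintegral => //; first exact: integrable_lorentz.
  move=> t /Rplus_ge0 t0.
  by rewrite gexpE /= !mul0r cos0 mulr1 mul1r; exact: bump_le_lorentz.
rewrite -lee_fin fineK; last by apply: integrable_fin_num => //; exact: integrable_lorentz.
exact: integral_lorentz_le.
Qed.

End BumpMass.

(** * A single hump and its transform *)

Section Hump.
Context {R : realType}.
Local Notation C := (complex R).
Local Notation mu := (@lebesgue_measure R).
Variables (j : nat) (s a : R).
Hypotheses (j0 : (0 < j)%N) (s1 : 1 <= s) (a0 : 0 <= a).

Definition hump_rate : C := Complex 1 (- s).
Definition hump_coef : C := Complex (a * bump_norm j.+1) 0.

(** A modulated bump of height a and frequency s, concentrated near
    t = j.+1. *)
Definition hump (t : R) : C := hump_coef * gexp j.+1 hump_rate t.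

(** Minus the derivative of the hump, since f is minus the derivative of
    f^(0) - int_0^t f. *)
Definition dhump (t : R) : C := - hump_coef * dgexp j.+1 hump_rate t.

Definition hump_transform (z : C) : C :=
  - (hump_coef * (j.+1)`!%:R) * (z / (z + hump_rate) ^+ j.+2).

Let ca0 : 0 <= a * bump_norm j.+1.
Proof. by rewrite mulr_ge0 // ltW // bump_norm_gt0. Qed.

Let mR : measurable (Rplus : set (measurableTypeR R)).
Proof. exact: measurable_Rplus. Qed.

Lemma cmod_hump_coef : cmod hump_coef = a * bump_norm j.+1.
Proof. by rewrite cmod_real ger0_norm. Qed.

Lemma cmod_hump t : 0 <= t ->
  cmod (hump t) = a * (bump_norm j.+1 * (t ^+ j.+1 * expR (- t))).
Proof. by move=> t0; rewrite cmodM cmod_hump_coef cmod_gexp //= mul1r mulrA. Qed.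

Lemma cmod_hump_le t : 0 <= t -> cmod (hump t) <= a.
Proof. by move=> t0; rewrite cmod_hump // ler_piMr // bump_le1. Qed.

Lemma cmod_hump_ge t : j.+1%:R <= t <= j.+1%:R + Num.sqrt j.+1%:R / 2 ->
  3 / 4 * a <= cmod (hump t).
Proof.
move=> ht; have t0 : 0 <= t by case/andP: ht => h _; apply: le_trans h.
by rewrite cmod_hump // mulrC ler_wpM2l // bump_ge.
Qed.

Lemma cmod_hump_rate : cmod hump_rate <= 1 + s.
Proof.
rewrite (le_trans (le_cmod_ReIm _)) //= normr1 normrN ger0_norm //.
exact: le_trans s1.
Qed.

Lemma cmod_dhump_le t : 0 <= t ->
  cmod (dhump t) <= a * s * (2 + expR 1) * lorentz j t.
Proof.
move=> t0; rewrite cmodM cmodN cmod_hump_coef -mulrA.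
have D0 := ltW (lorentz_gt0 j t).
have b0 := ltW (@bump_norm_gt0 R j.+1).
have s0 : 0 <= s by apply: le_trans s1.
rewrite -!mulrA ler_wpM2l //.
apply: (@le_trans _ _ (bump_norm j.+1 * (j.+1%:R * (t ^+ j * expR (- t)) +
   (1 + s) * (t ^+ j.+1 * expR (- t))))).
  rewrite ler_wpM2l // (le_trans (cmodB _ _)) //.
  rewrite cmodM cmod_natr cmod_gexp //= cmodM cmod_gexp //= !mul1r.
  by rewrite lerD2l ler_wpM2r ?cmod_hump_rate // mulr_ge0 ?exprn_ge0 ?expR_ge0.
rewrite mulrDr mulrCA [X in _ + X]mulrCA [X in X + _ <= _]mulrCA.
apply: (@le_trans _ _ (expR 1 * lorentz j t + (1 + s) * lorentz j t)).
  apply: lerD; first exact: bump_deriv_le_lorentz.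
  by rewrite ler_wpM2l ?bump_le_lorentz // addr_ge0.
rewrite -mulrDl mulrA ler_wpM2r //.
have : 0 <= (s - 1) * expR 1 by rewrite mulr_ge0 ?expR_ge0 ?subr_ge0.
move: (expR 1) => e h; rewrite -subr_ge0.
rewrite (_ : _ - _ = (s - 1) * e + (s - 1)); last by ring.
by rewrite addr_ge0 // subr_ge0.
Qed.

Lemma ccontinuous_hump : ccontinuous hump.
Proof. exact/ccontinuousZ/ccontinuous_gexp. Qed.

Lemma ccontinuous_dhump : ccontinuous dhump.
Proof. exact/ccontinuousZ/ccontinuous_dgexp. Qed.

Lemma cintegral_dhump t : 0 <= t -> cintegral `[0, t] dhump = - hump t.
Proof.
move=> t0; have ci : cintegrable `[0, t] (dgexp j.+1 hump_rate).
  have [cR cI] := ccontinuous_dgexp j.+1 hump_rate.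
  split; (apply: continuous_compact_integrable; first exact: segment_compact);
    exact: continuous_subspaceT.
rewrite cintegralZ; [|exact: measurable_itv|exact: ci].
rewrite (cintegral_FTC t0 (is_cderive_gexp _ _) (ccontinuous_dgexp _ _)).
by rewrite gexp0 subr0 mulNr.
Qed.

Lemma gexp_shift i (z w : C) t :
  cexp (- (z * Complex t 0)) * gexp i w t = gexp i (z + w) t.
Proof. by rewrite /gexp mulrCA -cexpD mulrDl opprD. Qed.

(** Integration by parts: the boundary terms vanish, so the transform of minus
    the derivative is -z times the transform of the hump. *)
Lemma laplace_dhump z : 0 < complex.Re z -> laplace dhump z = hump_transform z.
Proof.
move=> z0; set w := z + hump_rate.
have w0 : 0 < complex.Re w by rewrite ReD /= addr_gt0.
have E : (fun t => cexp (- (z * Complex t 0)) * dhump t) =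
    (fun t => - hump_coef * (z * gexp j.+1 w t + dgexp j.+1 w t)).
  apply/funext => t; rewrite /dhump /dgexp mulrCA; congr (_ * _).
  rewrite mulrBr (mulrCA (cexp _) j.+1%:R) (mulrCA (cexp _) hump_rate).
  by rewrite !gexp_shift -/w /w; ring.
have i1 := cintegrable_gexp j.+1 w0; have i2 := cintegrable_gexp j w0.
have id : cintegrable Rplus (dgexp j.+1 w).
  rewrite /dgexp; under eq_fun do rewrite -mulNr.
  by apply: cintegrableD => //; exact: cintegrableZ.
rewrite /laplace E cintegralZ //; last by apply: cintegrableD => //; exact: cintegrableZ.
rewrite cintegralD //; last exact: cintegrableZ.
rewrite cintegralZ // cintegral_gexp // (cintegral_FTCy (is_cderive_gexp j.+1 w)) //.
- by rewrite gexp0 oppr0 addr0 /hump_transform -/w; ring.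
- exact: ccontinuous_dgexp.
- exact: cvgy_cmod_gexp.
Qed.

(** An upper bound for the L^1 norm of the hump. *)
Definition hump_mass : R := 8 * pi * Num.sqrt j.+1%:R * a.

Lemma hump_mass_ge0 : 0 <= hump_mass.
Proof. by rewrite !mulr_ge0 ?pi_ge0 ?sqrtr_ge0. Qed.

Lemma cmod_hump_coef_fact :
  cmod (hump_coef * (j.+1)`!%:R) <= hump_mass.
Proof.
rewrite cmodM cmod_hump_coef cmod_natr -mulrA mulrC ler_wpM2r //.
exact: bump_mass.
Qed.

(** One factor of the denominator absorbs |z|, at the price of a factor of
    order s. *)
Lemma cmod_hump_transform_le z : 1 / 2 <= cmod (z + hump_rate) ->
  cmod (hump_transform z) <= 5 * s * hump_mass * cmod (z + hump_rate) ^- j.+1.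
Proof.
move=> hz; set W := cmod (z + hump_rate) in hz *.
have W0 : 0 < W by lra.
have Wj : 0 <= W ^- j.+1 by rewrite invr_ge0 exprn_ge0 // ltW.
have zW : cmod z / W <= 5 * s.
  rewrite ler_pdivrMr //.
  have -> : z = (z + hump_rate) - hump_rate by rewrite addrK.
  rewrite (le_trans (cmodB _ _)) // -/W.
  have h1 : W <= s * W by rewrite ler_peMl // ltW.
  have h2 : s <= 2 * (s * W).
    by rewrite mulrCA ler_peMr //; [exact: le_trans s1|lra].
  have h3 := cmod_hump_rate; have h4 := s1.
  by rewrite -mulrA; move: (s * W) h1 h2 => P; lra.
rewrite cmodM cmodN [X in _ * X]cmodM cmodV cmodX -/W [W ^+ j.+2]exprS invfM.
rewrite [X in _ * X]mulrA mulrA ler_wpM2r //.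
rewrite [5 * s * _]mulrC; apply: ler_pM => //; rewrite ?cmod_ge0 //.
  by rewrite divr_ge0 ?cmod_ge0 // ltW.
exact: cmod_hump_coef_fact.
Qed.

Definition hump_transform_deriv (z : C) : C :=
  - (hump_coef * (j.+1)`!%:R) *
  (hump_rate * (j.+2%:R * (z + hump_rate) ^- j.+3) -
   j.+1%:R * (z + hump_rate) ^- j.+2).

Definition hump_remainder (m : R) : R :=
  hump_mass * ((j.+1 * j.+2)%:R * m ^- j.+3 +
    (1 + s) * ((j.+2 * j.+3)%:R * m ^- j.+4)).

Lemma hump_remainder_ge0 (m : R) : 0 < m -> 0 <= hump_remainder m.
Proof.
move=> m0; have V i : 0 <= m ^- i by rewrite invr_ge0 exprn_ge0 // ltW.
rewrite /hump_remainder; apply: mulr_ge0; first exact: hump_mass_ge0.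
apply: addr_ge0; first exact: mulr_ge0.
apply: mulr_ge0; last exact: mulr_ge0.
by rewrite addr_ge0 // (le_trans ler01 s1).
Qed.

(** Writing the numerator z as (z + m) - m, with m the rate of the hump, splits
    the transform into two pure powers. *)
Lemma hump_transform_taylor (z h : C) (m : R) : 0 < m ->
  m <= cmod (z + hump_rate) -> m <= cmod (z + h + hump_rate) ->
  cmod (hump_transform (z + h) - hump_transform z - h * hump_transform_deriv z)
    <= hump_remainder m * cmod h ^+ 2.
Proof.
move=> m0; set w := z + hump_rate.
have -> : z + h + hump_rate = w + h by rewrite /w; ring.
move=> mw mwh.
have w0 : w != 0 by rewrite -cmod_eq0 gt_eqF // (lt_le_trans m0).
have wh0 : w + h != 0 by rewrite -cmod_eq0 gt_eqF // (lt_le_trans m0).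
have T1 := inv_pow_taylor j.+1 m0 mw mwh.
have T2 := inv_pow_taylor j.+2 m0 mw mwh.
set E1 := (X in cmod X <= _) in T1; set E2 := (X in cmod X <= _) in T2.
have split_frac (x : C) : x != 0 ->
    (x - hump_rate) / x ^+ j.+2 = x ^- j.+1 - hump_rate * x ^- j.+2.
  move=> x0; rewrite mulrBl; congr (_ - _).
  by rewrite exprS invfM mulrA divff ?mul1r.
have -> : hump_transform (z + h) - hump_transform z - h * hump_transform_deriv z =
    - (hump_coef * (j.+1)`!%:R) * (E1 - hump_rate * E2).
  rewrite /hump_transform /hump_transform_deriv -/w.
  have -> : z + h + hump_rate = w + h by rewrite /w; ring.
  have -> : z + h = (w + h) - hump_rate by rewrite /w; ring.
  have -> : z = w - hump_rate by rewrite /w; ring.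
  by rewrite !split_frac // /E1 /E2; ring.
rewrite cmodM cmodN /hump_remainder -mulrA.
apply: ler_pM; rewrite ?cmod_ge0 ?cmod_hump_coef_fact //.
rewrite (le_trans (cmodB _ _)) // mulrDl lerD // cmodM -mulrA.
by apply: ler_pM; rewrite ?cmod_ge0 ?cmod_hump_rate.
Qed.

End Hump.

(** * Frequency and height of a hump *)

Section Asymptotics.
Context {R : realType}.
Local Notation C := (complex R).

Lemma gt0_powRD (x r t : R) : 0 < x -> x `^ (r + t) = x `^ r * x `^ t.
Proof. by move=> x0; rewrite powRD //; apply/implyP => _; rewrite gt_eqF. Qed.

Lemma ln_le_powR (e x : R) : 0 < e -> 0 < x -> ln x <= x `^ e / e.
Proof.
move=> e0 x0; rewrite ler_pdivlMr // mulrC -ln_powR ltW // ln_sublinear //.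
by rewrite powR_gt0.
Qed.

Lemma near_powR_ge (e M : R) : 0 < e -> \forall k \near \oo, M <= k%:R `^ e.
Proof.
move=> e0; near=> k.
have M0 : 0 <= Num.max M 0 by rewrite le_max lexx orbT.
apply: (@le_trans _ _ (Num.max M 0)); first by rewrite le_max lexx.
have -> : Num.max M 0 = (Num.max M 0 `^ e^-1) `^ e.
  by rewrite -powRrM mulVf ?powRr1 // gt_eqF.
apply: ge0_ler_powR; rewrite ?nnegrE ?powR_ge0 ?(ltW e0) //.
by near: k; exact: nbhs_infty_ger.
Unshelve. all: by end_near. Qed.

Lemma near_ln_le_powR (e M : R) : 0 < e -> 0 <= M ->
  \forall k \near \oo, M * ln k%:R <= k%:R `^ e.
Proof.
move=> e0 M0; have e2 : 0 < e / 2 by rewrite divr_gt0.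
near=> k.
have k0 : 0 < k%:R :> R by near: k; exact: nbhs_infty_gtr.
apply: (@le_trans _ _ (M * (k%:R `^ (e / 2) / (e / 2)))).
  by rewrite ler_wpM2l // ln_le_powR.
have -> : k%:R `^ e = k%:R `^ (e / 2) * k%:R `^ (e / 2) :> R.
  by rewrite -gt0_powRD //; congr (_ `^ _); field.
rewrite mulrCA ler_wpM2l ?powR_ge0 //.
by near: k; exact: near_powR_ge.
Unshelve. all: by end_near. Qed.

Lemma expR_half_le2 : expR 2^-1 <= 2 :> R.
Proof.
have := expR_ge1Dx (- 2^-1 : R); rewrite expRN => h.
rewrite -lef_pV2 ?posrE ?expR_gt0 //; apply: le_trans h; lra.
Qed.

Lemma expR1_le4 : expR 1 <= 4 :> R.
Proof.
rewrite [X in expR X](_ : 1 = 2%:R * 2^-1 :> R); last by field.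
rewrite expRM_natl (_ : 4 = 2 ^+ 2); last by rewrite -natrX.
by rewrite lerXn2r ?nnegrE ?expR_ge0 ?expR_half_le2.
Qed.

Lemma near_pow_le_exp2 (q : nat) (M : R) : 0 <= M ->
  \forall k \near \oo, M * k%:R ^+ q <= 2 ^+ k.
Proof.
move=> M0; near=> k.
have k0 : 0 <= k%:R :> R by [].
have h1 := pow_le_expR q.+1 (divr_ge0 k0 (ler0n R 2)).
have h2 : expR (k%:R / 2) <= 2 ^+ k :> R.
  by rewrite expRM_natl lerXn2r // ?nnegrE ?expR_ge0 // expR_half_le2.
have h3 : M * (2 ^+ q.+1 * (q.+1)`!%:R) <= k%:R by near: k; exact: nbhs_infty_ger.
have c0 : 0 < 2 ^+ q.+1 * (q.+1)`!%:R :> R by rewrite mulr_gt0 ?exprn_gt0 // ltr0n fact_gt0.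
rewrite -(ler_pM2l c0).
apply: (@le_trans _ _ (k%:R ^+ q.+1)).
  by rewrite [k%:R ^+ q.+1]exprS mulrA ler_wpM2r ?exprn_ge0 // mulrC.
have -> : k%:R ^+ q.+1 = 2 ^+ q.+1 * (k%:R / 2) ^+ q.+1 :> R.
  by rewrite -exprMn; congr (_ ^+ _); field.
rewrite -mulrA ler_wpM2l ?exprn_ge0 // (le_trans h1) // ler_wpM2l //.
Unshelve. all: by end_near. Qed.


(** Chosen so that (1 - rho)^-k, with rho = (s/2)^-alpha and s the frequency below,
    is at most k^(1/(4p)). *)
Definition freq_const (alpha p : R) : R := 2 `^ (alpha + 1) * (4 * p).

(** The frequency s for which s^alpha ln s is comparable to the location k. *)
Definition freq (alpha p : R) (k : nat) : R :=
  (freq_const alpha p * k%:R / ln k%:R) `^ alpha^-1.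

(** The height for which the derivative of the hump has an L^p norm of order d. *)
Definition amp (alpha p d : R) (k : nat) : R :=
  d / (freq alpha p k * k%:R `^ (2 * p)^-1).

Lemma freq_const_ge1 (alpha p : R) : 0 < alpha -> 1 <= p -> 1 <= freq_const alpha p.
Proof.
move=> alpha0 p1.
have h : 1 <= 2 `^ (alpha + 1) :> R.
  by rewrite -[leLHS](powRr0 2) ler_powR ?ler1n // addr_ge0 // ltW.
have := ler_pM ler01 (ler01 : 0 <= 1 :> R) h (_ : 1 <= 4 * p); rewrite mul1r; apply; lra.
Qed.

Lemma freq_const_gt0 (alpha p : R) : 0 < alpha -> 1 <= p -> 0 < freq_const alpha p.
Proof. by move=> alpha0 p1; apply: lt_le_trans (freq_const_ge1 alpha0 p1). Qed.

Lemma freqX (alpha p : R) (k : nat) : 0 < alpha -> 1 <= p -> (2 <= k)%N ->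
  freq alpha p k `^ alpha = freq_const alpha p * k%:R / ln k%:R.
Proof.
move=> alpha0 p1 k2; have A0 := freq_const_gt0 alpha0 p1.
rewrite /freq -powRrM mulVf ?gt_eqF // powRr1 //.
apply: divr_ge0; first by rewrite mulr_ge0 ?(ltW A0).
by rewrite ln_ge0 // ler1n; lia.
Qed.

Lemma near_freq_ge (alpha p M : R) : 0 < alpha -> 1 <= p ->
  \forall k \near \oo, M <= freq alpha p k.
Proof.
move=> alpha0 p1; have A0 := freq_const_gt0 alpha0 p1.
have A1 := freq_const_ge1 alpha0 p1; have ap : 0 < 2^-1 / alpha by rewrite divr_gt0.
near=> k.
have k2 : (2 <= k)%N by near: k; exact: nbhs_infty_ge.
have k0 : 0 < k%:R :> R by rewrite ltr0n (leq_trans _ k2).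
have L0 : 0 < ln (k%:R : R) by rewrite ln_gt0 // ltr1n.
apply: (@le_trans _ _ ((k%:R `^ 2^-1) `^ alpha^-1)).
  by rewrite -powRrM; near: k; exact: near_powR_ge.
apply: ge0_ler_powR; rewrite ?nnegrE ?powR_ge0 ?invr_ge0 ?(ltW alpha0) //.
  by apply: divr_ge0; [apply: mulr_ge0|]; apply: ltW.
rewrite ler_pdivlMr //.
apply: (@le_trans _ _ (k%:R `^ 2^-1 * k%:R `^ 2^-1)).
  rewrite ler_wpM2l ?powR_ge0 // -[leLHS]mul1r; near: k.
  by apply: near_ln_le_powR; rewrite ?invr_gt0.
rewrite -gt0_powRD //.
rewrite (_ : 2^-1 + 2^-1 = 1); last by field.
by rewrite powRr1 ?(ltW k0) // ler_peMl ?A1 // ltW.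
Unshelve. all: by end_near. Qed.

Lemma amp_ge0 (alpha p d : R) k : 0 <= d -> 0 <= amp alpha p d k.
Proof. by move=> d0; rewrite divr_ge0 // mulr_ge0 ?powR_ge0. Qed.

Lemma near_amp_le (alpha p d M : R) : 0 < alpha -> 1 <= p -> 0 <= d -> 0 < M ->
  \forall k \near \oo, amp alpha p d k <= M.
Proof.
move=> alpha0 p1 d0 M0; have p0 : 0 < p by apply: lt_le_trans p1.
near=> k.
have k2 : (2 <= k)%N by near: k; exact: nbhs_infty_ge.
have f1 : d / M + 1 <= freq alpha p k by near: k; exact: near_freq_ge.
have f0 : 0 < freq alpha p k by rewrite (lt_le_trans _ f1) // ltr_wpDl ?divr_ge0 // ltW.
have K1 : 1 <= k%:R `^ (2 * p)^-1 :> R.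
  rewrite -[leLHS](powRr0 k%:R) ler_powR ?ler1n ?invr_ge0 ?mulr_ge0 ?(ltW p0) //.
  by rewrite (leq_trans _ k2).
rewrite /amp ler_pdivrMr; last by rewrite mulr_gt0 // (lt_le_trans _ K1).
apply: (@le_trans _ _ (M * freq alpha p k)); last first.
  by rewrite ler_wpM2l ?(ltW M0) // ler_peMr ?(ltW f0).
rewrite mulrC -ler_pdivrMr // (le_trans _ f1) // lerDl //.
Unshelve. all: by end_near. Qed.

(** The heights decrease at most polynomially, so the exponential tail of one
    hump is negligible with respect to every later hump. *)
Lemma near_amp_ge (alpha p d : R) (i : nat) (M : R) : 0 < alpha -> 1 <= p -> 0 < d -> 0 <= M ->
  \forall k \near \oo, forall t, k%:R <= t ->
    M * (t ^+ i * expR (- t)) <= amp alpha p d k.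
Proof.
move=> alpha0 p1 d0 M0; have A0 := freq_const_gt0 alpha0 p1.
have A1 := freq_const_ge1 alpha0 p1.
pose q := (Num.truncn (alpha^-1 + (2 * p)^-1)).+1.
pose B := freq_const alpha p `^ alpha^-1.
have B0 : 0 < B by rewrite powR_gt0 // A0.
near=> k => t kt.
have k4 : (4 <= k)%N by near: k; exact: nbhs_infty_ge.
have k0 : 0 < k%:R :> R by rewrite ltr0n (leq_trans _ k4).
have k1 : 1 <= k%:R :> R by rewrite ler1n (leq_trans _ k4).
have t0 : 0 < t by apply: lt_le_trans kt.
have L1 : 1 <= ln (k%:R : R).
  rewrite -[leLHS](expRK 1) ler_ln ?posrE ?expR_gt0 //.
  by rewrite (le_trans expR1_le4) // ler_nat.
have fk : freq alpha p k <= B * k%:R `^ alpha^-1.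
  rewrite /freq /B -powRM ?(ltW A0) ?(ltW k0) //.
  apply: ge0_ler_powR; rewrite ?nnegrE ?invr_ge0 ?(ltW alpha0) //.
  - by rewrite divr_ge0 ?mulr_ge0 ?(ltW A0) ?(ltW k0) // (le_trans ler01).
  - by rewrite mulr_ge0 ?(ltW A0) ?(ltW k0).
  - by rewrite ler_pdivrMr ?(lt_le_trans ltr01) // ler_peMr // mulr_ge0 ?(ltW A0) ?(ltW k0).
have f0 : 0 < freq alpha p k.
  by apply: powR_gt0; apply: divr_gt0; [apply: mulr_gt0|apply: lt_le_trans L1].
have ka : d / (B * k%:R ^+ q) <= amp alpha p d k.
  have h1 : 0 < B * k%:R ^+ q by rewrite mulr_gt0 ?exprn_gt0.
  have h2 : 0 < freq alpha p k * k%:R `^ (2 * p)^-1.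
    by apply: mulr_gt0 => //; exact: powR_gt0.
  rewrite ler_wpM2l ?(ltW d0) // lef_pV2 ?posrE //.
  apply: (@le_trans _ _ (B * k%:R `^ alpha^-1 * k%:R `^ (2 * p)^-1)).
    by rewrite ler_wpM2r ?powR_ge0.
  rewrite -mulrA ler_wpM2l ?(ltW B0) // -gt0_powRD //.
  by rewrite -powR_mulrn ?(ltW k0) // ler_powR // ltW // truncnS_gt.
apply: le_trans ka.
have tq : t ^+ i * expR (- t) <= (i + q.+1)`!%:R / k%:R ^+ q.+1.
  rewrite ler_pdivlMr ?exprn_gt0 //.
  apply: (@le_trans _ _ (t ^+ (i + q.+1) * expR (- t))).
    rewrite exprD mulrAC ler_wpM2r ?expR_ge0 // ler_wpM2l ?exprn_ge0 ?(ltW t0) //.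
    by rewrite lerXn2r // nnegrE ltW.
  by rewrite expRN ler_pdivrMr ?expR_gt0 // pow_le_expR // ltW.
apply: le_trans (ler_wpM2l M0 tq) _.
rewrite mulrA ler_pdivrMr ?exprn_gt0 // exprS.
rewrite mulrAC ler_pdivlMr ?mulr_gt0 ?exprn_gt0 //.
rewrite [leRHS]mulrA mulrA ler_wpM2r ?exprn_ge0 ?(ltW k0) //.
rewrite mulrC [d * _]mulrC -ler_pdivrMr //.
by near: k; exact: nbhs_infty_ger.
Unshelve. all: by end_near. Qed.

End Asymptotics.

(** * Bounds on the transform of a hump *)

Section HumpAsymptotics.
Context {R : realType}.
Local Notation C := (complex R).

Lemma near_succ (P : nat -> Prop) :
  (\forall k \near \oo, P k) -> \forall j \near \oo, P j.+1.
Proof. by move=> [N _ h]; exists N => //= j /= Nj; apply: h => /=; exact: leqW. Qed.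

Lemma hump_mass_freq (alpha p d : R) (j : nat) : 0 < freq alpha p j.+1 ->
  freq alpha p j.+1 * hump_mass j (amp alpha p d j.+1) =
  8 * pi * d * (Num.sqrt j.+1%:R * (j.+1%:R `^ (2 * p)^-1)^-1).
Proof.
move=> s0; have K0 : 0 < j.+1%:R `^ (2 * p)^-1 :> R by rewrite powR_gt0.
by rewrite /hump_mass /amp; field; rewrite !gt_eqF.
Qed.

Lemma hump_mass_freq_le (alpha p d : R) (j : nat) : 0 < p -> 0 <= d ->
  0 < freq alpha p j.+1 ->
  freq alpha p j.+1 * hump_mass j (amp alpha p d j.+1) <= 8 * pi * d * j.+1%:R.
Proof.
move=> p0 d0 s0; rewrite hump_mass_freq //.
have K1 : 1 <= j.+1%:R `^ (2 * p)^-1 :> R.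
  by rewrite -[leLHS](powRr0 j.+1%:R) ler_powR ?ler1n ?invr_ge0 ?mulr_ge0 ?(ltW p0).
rewrite ler_wpM2l ?mulr_ge0 ?pi_ge0 //.
rewrite ler_pdivrMr ?(lt_le_trans _ K1) // (le_trans _ (ler_peMr _ K1)) //.
rewrite -[leRHS]ger0_norm // -sqrtr_sqr ler_wsqrtr //.
by rewrite -natrX ler_nat expnS expn1 leq_pmulr.
Qed.

Lemma inv_pow_le_expR (rho : R) (k : nat) : 0 <= rho -> rho <= 1 / 2 ->
  (1 - rho) ^- k <= expR (2 * rho * k%:R).
Proof.
move=> r0 r1; have h : 0 < 1 - rho by lra.
rewrite mulrC expRM_natl -exprVn lerXn2r // ?nnegrE ?invr_ge0 ?(ltW h) ?expR_ge0 //.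
rewrite -[leLHS]mul1r ler_pdivrMr //.
have := expR_ge1Dx (2 * rho); have := expR_ge0 (2 * rho).
move: (expR (2 * rho)) => e e0 e1.
have : (1 + 2 * rho) * (1 - rho) <= e * (1 - rho) by rewrite ler_wpM2r ?(ltW h).
apply: le_trans; rewrite -subr_ge0 (_ : _ - _ = rho * (1 - 2 * rho)); last by ring.
by rewrite mulr_ge0 //; lra.
Qed.

(** Each of k factors of the denominator contributes at most 1/2, and 2^-k beats
    every power of k. *)
Lemma near_hump_transform_far (alpha p : R) : 0 < alpha -> 1 <= p ->
  \forall j \near \oo, forall (d : R) (z : C), 0 <= d ->
    2 <= cmod (z + hump_rate (freq alpha p j.+1)) ->
    cmod (hump_transform j (freq alpha p j.+1) (amp alpha p d j.+1) z) <= d.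
Proof.
move=> alpha0 p1; have p0 : 0 < p by apply: lt_le_trans p1.
have c1 : 0 <= 40 * pi :> R by rewrite mulr_ge0 ?pi_ge0.
have N1 := near_succ (near_freq_ge 1 alpha0 p1).
have N3 := near_succ (near_pow_le_exp2 1 c1).
have N4 : \forall j \near \oo, (1 <= j)%N by exact: nbhs_infty_ge.
near=> j => d z d0 W2.
have s1 : 1 <= freq alpha p j.+1 by near: j.
have hP : 40 * pi * j.+1%:R ^+ 1 <= 2 ^+ j.+1 :> R by near: j.
have j0 : (0 < j)%N by near: j.
set s := freq alpha p j.+1 in s1 W2 *; set a := amp alpha p d j.+1.
have a0 : 0 <= a by exact: amp_ge0.
have s0 : 0 < s by lra.
have m0 := hump_mass_ge0 j a0.
apply: le_trans (cmod_hump_transform_le j0 s1 a0 _) _; first by lra.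
rewrite -[5 * s * _]mulrA.
have h1 := @hump_mass_freq_le alpha p d j p0 d0 s0.
have h2 : cmod (z + hump_rate s) ^- j.+1 <= 2 ^- j.+1.
  rewrite lef_pV2 ?posrE ?exprn_gt0 //; last by lra.
  by rewrite lerXn2r // nnegrE //; lra.
apply: (@le_trans _ _ (5 * (8 * pi * d * j.+1%:R) * 2 ^- j.+1)).
  apply: ler_pM => //; first by rewrite mulr_ge0 // mulr_ge0 // ltW.
    by rewrite invr_ge0 exprn_ge0 ?cmod_ge0.
  by rewrite ler_wpM2l.
rewrite ler_pdivrMr ?exprn_gt0 //.
rewrite expr1 in hP.
have := ler_wpM2l d0 hP; apply: le_trans; rewrite le_eqVlt; apply/orP; left.
by apply/eqP; ring.
Unshelve. all: by end_near. Qed.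

(** When Im z < s/2 the point is far from the frequency.  Otherwise
    1 + Re z >= 1 - (s/2)^-alpha, and the power of the denominator costs at most
    q = k^(1/(4p)); since the height of the hump contributes q^-2, a factor q^-1
    is left to compensate the logarithm in s^alpha = A k / ln k. *)
Lemma near_hump_transform_le (alpha p : R) : 0 < alpha -> 1 <= p ->
  \forall j \near \oo, forall (d : R) (z : C), 0 <= d -> Omega alpha z ->
    cmod (hump_transform j (freq alpha p j.+1) (amp alpha p d j.+1) z) <=
    d * (1 + `|complex.Im z|) `^ (alpha / 2).
Proof.
move=> alpha0 p1; have p0 : 0 < p by apply: lt_le_trans p1.
have A0 := freq_const_gt0 alpha0 p1.
have e0 : 0 < (2 * p)^-1 by rewrite invr_gt0 mulr_gt0.
have c0 : 0 <= (40 * pi) ^+ 2 :> R by rewrite sqr_ge0.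
have c1 : 0 <= 40 * pi :> R by rewrite mulr_ge0 ?pi_ge0.
have N1 := near_succ (near_freq_ge 4 alpha0 p1).
have N2 := near_succ (near_ln_le_powR e0 c0).
have N3 := near_hump_transform_far alpha0 p1.
have N4 : \forall j \near \oo, (3 <= j)%N by exact: nbhs_infty_ge.
near=> j => d z d0 Oz.
have s4 : 4 <= freq alpha p j.+1 by near: j.
have hL : (40 * pi) ^+ 2 * ln j.+1%:R <= j.+1%:R `^ (2 * p)^-1 :> R by near: j.
have hfar : forall (d : R) (z : C), 0 <= d ->
    2 <= cmod (z + hump_rate (freq alpha p j.+1)) ->
    cmod (hump_transform j (freq alpha p j.+1) (amp alpha p d j.+1) z) <= d.
  by near: j.
have j3 : (3 <= j)%N by near: j.
set s := freq alpha p j.+1 in s4 hfar *; set a := amp alpha p d j.+1.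
have a0 : 0 <= a by exact: amp_ge0.
have s1 : 1 <= s by lra.
have s0 : 0 < s by lra.
have j0 : (0 < j)%N by apply: leq_trans j3.
have K0 : 0 < j.+1%:R :> R by rewrite ltr0n.
have L0 : 0 < ln (j.+1%:R : R) by rewrite ln_gt0 // ltr1n ltnS.
have m0 := hump_mass_ge0 j a0.
have y1 : 1 <= (1 + `|complex.Im z|) `^ (alpha / 2).
  by rewrite -[leLHS](powRr0 (1 + `|complex.Im z|)) ler_powR ?lerDl // divr_ge0 // ltW.
have [ys|ys] := ltP (complex.Im z) (s / 2).
  have W2 : 2 <= cmod (z + hump_rate s).
    apply: le_trans (le_Im_cmod _); rewrite ImD /= ler0_norm; lra.
  by apply: le_trans (hfar d z d0 W2) _; rewrite ler_peMr.
have yge : s / 2 <= `|complex.Im z| by rewrite (le_trans ys) // ler_norm.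
set K : R := j.+1%:R in K0 L0 hL *.
pose X := 8 * p * K / ln K.
have X0 : 0 < X by rewrite divr_gt0 // !mulr_gt0.
have sX : (s / 2) `^ alpha = X.
  rewrite powRM ?invr_ge0 ?(ltW s0) // freqX // -/K.
  rewrite -(powR_inv1 (ler0n _ 2)) -powRrM mulN1r powRN /freq_const.
  rewrite (gt0_powRD alpha 1) // powRr1 // /X.
  by field; rewrite !gt_eqF // powR_gt0.
have r1 : 1 / (1 + `|complex.Im z|) `^ alpha <= X^-1.
  have h1 : 0 < (s / 2) `^ alpha by rewrite sX.
  have h2 : 0 < (1 + `|complex.Im z|) `^ alpha by apply: powR_gt0; rewrite ltr_wpDr.
  rewrite div1r -sX lef_pV2 ?posrE //.
  apply: ge0_ler_powR; rewrite ?nnegrE ?(ltW alpha0) ?divr_ge0 ?(ltW s0) ?addr_ge0 //.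
  by rewrite (le_trans yge) // lerDr.
have X8 : 8 <= X.
  rewrite ler_pdivlMr // -mulrA ler_wpM2l // (le_trans (ltW (ln_sublinear K0))) //.
  by rewrite ler_peMl // ltW.
have rho8 : X^-1 <= 1 / 8 by rewrite div1r lef_pV2 ?posrE.
have rho0 : 0 <= X^-1 by rewrite invr_ge0 ltW.
have W1 : 1 - X^-1 <= cmod (z + hump_rate s).
  apply: le_trans (le_Re_cmod _); rewrite ReD /=.
  have := Oz; rewrite /Omega /= => Oz'; apply: le_trans (ler_norm _); lra.
apply: le_trans (cmod_hump_transform_le j0 s1 a0 _) _; first by apply: le_trans W1; lra.
pose q := K `^ (4 * p)^-1.
have q0 : 0 < q by rewrite powR_gt0.
have q2 : q ^+ 2 = K `^ (2 * p)^-1.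
  rewrite -powR_mulrn ?(ltW q0) // -powRrM; congr (_ `^ _); field.
  by rewrite gt_eqF.
have qE : expR (2 * X^-1 * K) = q.
  have -> : q = expR (ln q) by rewrite lnK.
  congr expR; rewrite ln_powR /X; field.
  by rewrite !gt_eqF.
have Wk : cmod (z + hump_rate s) ^- j.+1 <= q.
  rewrite -qE; apply: le_trans (inv_pow_le_expR j.+1 rho0 _); last by lra.
  rewrite lef_pV2 ?posrE ?exprn_gt0 //; [|by apply: lt_le_trans W1; lra|by lra].
  by rewrite lerXn2r // nnegrE ?cmod_ge0 //; lra.
rewrite -[5 * s * _]mulrA hump_mass_freq // -/K -q2.
apply: (@le_trans _ _ (5 * (8 * pi * d * (Num.sqrt K / q ^+ 2)) * q)).
  rewrite ler_wpM2l // !mulr_ge0 ?pi_ge0 ?sqrtr_ge0 //.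
  by rewrite invr_ge0 exprn_ge0 // ltW.
rewrite (_ : 5 * _ * q = d * (40 * pi * Num.sqrt K / q)); last by field; rewrite gt_eqF.
rewrite ler_wpM2l //.
apply: (@le_trans _ _ ((s / 2) `^ (alpha / 2))); last first.
  apply: ge0_ler_powR; rewrite ?nnegrE ?divr_ge0 ?(ltW s0) ?(ltW alpha0) ?addr_ge0 //.
  by rewrite (le_trans yge) // lerDr.
rewrite powRrM sX powR12_sqrt ?(ltW X0) //.
have x0 : 0 <= 40 * pi * Num.sqrt K / q.
  by rewrite divr_ge0 ?(ltW q0) // mulr_ge0 ?sqrtr_ge0.
rewrite -[leLHS]ger0_norm // -sqrtr_sqr ler_wsqrtr //.
rewrite 2!exprMn sqr_sqrtr ?(ltW K0) // exprVn q2.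
rewrite ler_pdivrMr ?powR_gt0 //.
apply: (@le_trans _ _ (K / ln K * K `^ (2 * p)^-1)).
  rewrite mulrC -[leRHS]mulrA ler_wpM2l ?(ltW K0) //.
  by rewrite ler_pdivlMl // mulrC.
rewrite ler_wpM2r ?powR_ge0 // /X ler_wpM2r ?invr_ge0 ?(ltW L0) //.
by rewrite ler_peMl ?(ltW K0) //; lra.
Unshelve. all: by end_near. Qed.

(** Away from the frequency the remainder carries a factor 2^-k, which beats the
    powers of k and s in front of it. *)
Lemma near_hump_remainder_le (alpha p : R) : 0 < alpha -> 1 <= p ->
  \forall j \near \oo, forall (d m : R), 0 <= d -> 2 <= m ->
    hump_remainder j (freq alpha p j.+1) (amp alpha p d j.+1) m <= d.
Proof.
move=> alpha0 p1; have p0 : 0 < p by apply: lt_le_trans p1.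
have sq9 i : (9 * i.+1 ^ 2 = 3 * i.+1 * (3 * i.+1))%N by rewrite mulnACA mulnn.
have n1 i : (i.+1 * i.+2 <= 9 * i.+1 ^ 2)%N by rewrite sq9; apply: leq_mul; lia.
have n2 i : (i.+2 * i.+3 <= 9 * i.+1 ^ 2)%N by rewrite sq9; apply: leq_mul; lia.
have c1 : 0 <= 216 * pi :> R by rewrite mulr_ge0 ?pi_ge0.
have N1 := near_succ (near_freq_ge 1 alpha0 p1).
have N3 := near_succ (near_pow_le_exp2 3 c1).
near=> j => d m d0 m2.
have s1 : 1 <= freq alpha p j.+1 by near: j.
have hP : 216 * pi * j.+1%:R ^+ 3 <= 2 ^+ j.+1 :> R by near: j.
have s0 := lt_le_trans ltr01 s1.
have a0 : 0 <= amp alpha p d j.+1 by exact: amp_ge0.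
have h1 := @hump_mass_freq_le alpha p d j p0 d0 s0.
have m0 := hump_mass_ge0 j a0.
set s := freq alpha p j.+1 in s1 s0 h1 *; set M := hump_mass _ _ in h1 m0 *.
set K : R := j.+1%:R in hP h1 *.
have K1 : 1 <= K by rewrite ler1n.
have mm i : (j.+1 <= i)%N -> m ^- i <= 2 ^- j.+1.
  move=> ji; rewrite lef_pV2 ?posrE ?exprn_gt0 //; last by lra.
  apply: (@le_trans _ _ (2 ^+ i)); first by rewrite ler_weXn2l // ler1n.
  by rewrite lerXn2r // nnegrE //; lra.
have P0 : 0 <= 2 ^- j.+1 :> R by rewrite invr_ge0 exprn_ge0.
have n9 (i : nat) : (i <= 9 * j.+1 ^ 2)%N -> i%:R <= 9 * K ^+ 2.
  by move=> h; rewrite -natrX -natrM ler_nat.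
apply: (@le_trans _ _ (M * (9 * K ^+ 2 * 2 ^- j.+1 + 2 * s * (9 * K ^+ 2 * 2 ^- j.+1)))).
  rewrite ler_wpM2l // lerD //.
    apply: ler_pM; [by []|by rewrite invr_ge0 exprn_ge0 //; lra|exact: n9|].
    by apply: mm; do 2 apply: leqW.
  have m0' : 0 <= m by lra.
  apply: ler_pM; [lra| |lra|].
    by rewrite mulr_ge0 // invr_ge0 exprn_ge0.
  apply: ler_pM; [by []|by rewrite invr_ge0 exprn_ge0|exact: n9|].
  by apply: mm; do 3 apply: leqW.
set Q := 2 ^- j.+1 in P0 *.
apply: (@le_trans _ _ (8 * pi * d * K * (27 * K ^+ 2 * Q))).
  have hMs : M <= s * M by rewrite ler_peMl.
  have hQ : 0 <= K ^+ 2 * Q by rewrite mulr_ge0 // exprn_ge0 // (le_trans ler01).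
  rewrite [leLHS](_ : _ = 9 * (M * (K ^+ 2 * Q)) + 18 * (s * M * (K ^+ 2 * Q))); last by ring.
  rewrite [leRHS](_ : _ = 27 * (8 * pi * d * K * (K ^+ 2 * Q))); last by ring.
  have := ler_wpM2r hQ hMs; have := ler_wpM2r hQ h1.
  move: (8 * pi * d * K * (K ^+ 2 * Q)) (s * M * (K ^+ 2 * Q)) (M * (K ^+ 2 * Q)) => u v w; lra.
rewrite [leLHS](_ : _ = d * (216 * pi * K ^+ 3) * Q); last by ring.
by rewrite ler_pdivrMr ?exprn_gt0 // ler_wpM2l.
Unshelve. all: by end_near. Qed.

End HumpAsymptotics.

(** * Sparse choice, and the weighted size of a hump *)

Section Selection.
Context {R : realType}.

Lemma near_forall_lt (N : nat) (P : nat -> nat -> Prop) :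
  (forall m, \forall k \near \oo, P m k) ->
  \forall k \near \oo, forall m, (m < N)%N -> P m k.
Proof.
move=> hP; elim: N => [|N IH]; first exact: nearW.
apply: filterS2 IH (hP N) => k h1 h2 m; rewrite ltnS leq_eqVlt => /predU1P[-> //|].
exact: h1.
Qed.

(** Inductive choice of a sparse sequence: each requirement on a new term
    involves the earlier terms and holds for all large values of the new one. *)
Lemma sparse_choice (A : nat -> nat -> Prop) (B : nat -> nat -> nat -> nat -> Prop) :
  (forall n, \forall k \near \oo, A n k) ->
  (forall m i n, \forall k \near \oo, B m i n k) ->
  exists u : nat -> nat, (forall n, A n (u n)) /\
    (forall m n, (m < n)%N -> B m (u m) n (u n)).
Proof.
move=> hA hB.
pose Q (l : seq nat) (k : nat) := A (size l) k /\
  forall m, (m < size l)%N -> B m (nth 0%N l m) (size l) k.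
have exQ l : exists k, Q l k.
  have : \forall k \near \oo, Q l k.
    apply: filterS2 (hA (size l)) (near_forall_lt (size l) _) => [k h1 h2|].
      by split; [exact: h1|exact: h2].
    by move=> m; exact: hB.
  by move=> [N _ h]; exists N; apply: h => /=.
have [next nextP] := choice exQ.
pose hist n := iter n (fun l => rcons l (next l)) [::].
have sz n : size (hist n) = n by elim: n => //= n IH; rewrite size_rcons IH.
have nth_hist n m : (m < n)%N -> nth 0%N (hist n) m = next (hist m).
  elim: n => //= n IH; rewrite ltnS leq_eqVlt => /predU1P[->|mn].
    by rewrite nth_rcons sz ltnn eqxx.
  by rewrite nth_rcons sz mn IH.
exists (fun n => next (hist n)); split=> [n|m n mn].
  by have [] := nextP (hist n); rewrite sz.
have [_] := nextP (hist n); rewrite sz => /(_ m mn).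
by rewrite nth_hist.
Qed.

Lemma invr_powR (x a : R) : 0 <= x -> x^-1 `^ a = (x `^ a)^-1.
Proof. by move=> x0; rewrite -powR_inv1 // -powRrM mulN1r powRN. Qed.

(** The level to which gamma must have dropped around a hump whose derivative has
    L^p norm d for the weighted norm of the hump to be of order M. *)
Definition weight_level (alpha p d M : R) : R :=
  (d / (2 * M)) `^ alpha / (2 * freq_const alpha p).

Lemma weight_level_gt0 (alpha p d M : R) : 0 < alpha -> 1 <= p -> 0 < d -> 0 < M ->
  0 < weight_level alpha p d M.
Proof.
move=> alpha0 p1 d0 M0; have A0 := freq_const_gt0 alpha0 p1.
apply: divr_gt0; last exact: mulr_gt0.
by apply: powR_gt0; apply: divr_gt0 => //; exact: mulr_gt0.
Qed.

(** On this interval (t / ln t)^(1/alpha) is comparable to the frequency, so the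
    weight restores the factor s lost in the height; what remains is the factor
    gamma^(-1/alpha), which the level turns into M. *)
Lemma weighted_amp_ge (alpha p d M gam t : R) (k : nat) :
  0 < alpha -> 1 <= p -> 0 < d -> 0 < M -> (4 <= k)%N ->
  k%:R <= t <= k%:R + Num.sqrt k%:R / 2 ->
  0 < gam <= weight_level alpha p d M ->
  M `^ p / Num.sqrt k%:R <=
  (amp alpha p d k / 2) `^ p * (t / (gam * ln (t + 2))) `^ (p / alpha).
Proof.
move=> alpha0 p1 d0 M0 k4 /andP[kt tk] /andP[g0 gle].
have A0 := freq_const_gt0 alpha0 p1; have p0 : 0 < p by apply: lt_le_trans p1.
have w0 := weight_level_gt0 alpha0 p1 d0 M0.
set K : R := k%:R in kt tk *.
have K4 : 4 <= K by rewrite ler_nat.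
have K0 : 0 < K by lra.
have t0 : 0 < t by lra.
have sK : Num.sqrt K <= K.
  rewrite -[leRHS]ger0_norm ?(ltW K0) // -sqrtr_sqr ler_wsqrtr // expr2 ler_peMl //; lra.
have L0 : 0 < ln K by rewrite ln_gt0 //; lra.
have Lt0 : 0 < ln (t + 2) by rewrite ln_gt0 //; lra.
have Lt : ln (t + 2) <= 2 * ln K.
  rewrite mulrC mulr_natr -lnXn // ler_ln ?posrE ?exprn_gt0 //; last by lra.
  rewrite expr2; have : 4 * K <= K * K by rewrite ler_wpM2r // ltW.
  lra.
pose s := freq alpha p k.
pose base := freq_const alpha p * K / ln K.
have base0 : 0 < base by rewrite divr_gt0 // mulr_gt0.
have s0 : 0 < s by exact: powR_gt0.
pose x := s * (2 * M / d).
have x0 : 0 < x by rewrite !mulr_gt0 ?invr_gt0.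
have h1 : x `^ alpha <= t / (gam * ln (t + 2)).
  have -> : x `^ alpha = K / (weight_level alpha p d M * (2 * ln K)).
    rewrite /x powRM ?(ltW s0) ?divr_ge0 ?mulr_ge0 ?(ltW M0) ?(ltW d0) //.
    rewrite freqX //; last by apply: leq_trans k4.
    rewrite /weight_level -[2 * M / d]invf_div.
    rewrite invr_powR ?divr_ge0 ?mulr_ge0 ?(ltW M0) ?(ltW d0) // -/K.
    field; rewrite !gt_eqF //.
    by apply: powR_gt0; apply: divr_gt0 => //; exact: mulr_gt0.
  have hw : 0 < weight_level alpha p d M * (2 * ln K).
    by apply: mulr_gt0 => //; exact: mulr_gt0.
  have hg : 0 < gam * ln (t + 2) by rewrite mulr_gt0.
  apply: ler_pM => //; first by rewrite invr_ge0 ltW.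
  rewrite lef_pV2 ?posrE //.
  by apply: ler_pM; rewrite ?(ltW g0) ?(ltW Lt0).
have h2 : x `^ p <= (t / (gam * ln (t + 2))) `^ (p / alpha).
  have -> : x `^ p = (x `^ alpha) `^ (p / alpha).
    by rewrite -powRrM mulrCA divff ?gt_eqF // mulr1.
  apply: ge0_ler_powR => //; rewrite ?nnegrE ?powR_ge0 //.
    by rewrite divr_ge0 // ltW.
  by rewrite divr_ge0 ?mulr_ge0 // ltW.
have am0 : 0 <= amp alpha p d k / 2 by rewrite divr_ge0 // amp_ge0 // ltW.
apply: le_trans (ler_wpM2l (powR_ge0 _ _) h2).
rewrite -powRM ?(ltW x0) //.
have -> : amp alpha p d k / 2 * x = M / K `^ (2 * p)^-1.
  by rewrite /amp /x -/s -/K; field; rewrite !gt_eqF // powR_gt0.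
rewrite powRM ?invr_ge0 ?powR_ge0 ?(ltW M0) //.
rewrite le_eqVlt; apply/orP; left; apply/eqP; congr (_ * _).
rewrite invr_powR ?powR_ge0 // -powRrM; congr (_^-1).
rewrite -powR12_sqrt ?(ltW K0) //; congr (_ `^ _).
by field; rewrite gt_eqF.
Qed.

End Selection.

(** * Superposition of the humps *)

Section Superposition.
Context {R : realType}.
Local Notation C := (complex R).
Local Notation mu := (@lebesgue_measure R).
Variables (alpha p : R) (j : nat -> nat).

(** One factor 2^-(n+1) makes the series converge, the other pays for the factors
    2^(n+1) in the estimate of the L^p norm of the sum. *)
Definition lp_size (n : nat) : R := 4^-1 ^+ n.+1.
Definition freq_seq (n : nat) : R := freq alpha p (j n).+1.
Definition amp_seq (n : nat) : R := amp alpha p (lp_size n) (j n).+1.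

Definition hump_seq n := hump (j n) (freq_seq n) (amp_seq n).
Definition dhump_seq n := dhump (j n) (freq_seq n) (amp_seq n).
Definition transform_seq n := hump_transform (j n) (freq_seq n) (amp_seq n).

Definition hump_sum (t : R) : C := csum (hump_seq ^~ t).
Definition dhump_sum (t : R) : C := csum (dhump_seq ^~ t).
Definition transform_sum (z : C) : C := csum (transform_seq ^~ z).

Hypotheses (alpha0 : 0 < alpha) (p1 : 1 <= p).
Hypothesis j_ge : forall n, (3 <= j n)%N.
Hypothesis freq_seq_ge : forall n, n%:R + 4 <= freq_seq n.
Hypothesis transform_le : forall n z, Omega alpha z ->
  cmod (transform_seq n z) <= lp_size n * (1 + `|complex.Im z|) `^ (alpha / 2).
Hypothesis transform_far : forall n z, 2 <= cmod (z + hump_rate (freq_seq n)) ->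
  cmod (transform_seq n z) <= lp_size n.
Hypothesis remainder_le : forall n m, 2 <= m ->
  hump_remainder (j n) (freq_seq n) (amp_seq n) m <= lp_size n.

Let p0 : 0 < p. Proof. exact: lt_le_trans p1. Qed.

Let j0 n : (0 < j n)%N. Proof. by apply: leq_trans (j_ge n). Qed.

Let mR : measurable (Rplus : set (measurableTypeR R)).
Proof. exact: measurable_Rplus. Qed.

Let freq_seq_ge4 n : 4 <= freq_seq n.
Proof. by rewrite (le_trans _ (freq_seq_ge n)) // lerDr. Qed.

Let freq_seq_ge1 n : 1 <= freq_seq n.
Proof. by rewrite (le_trans _ (freq_seq_ge4 n)) // ler1n. Qed.

Let freq_seq_gt0 n : 0 < freq_seq n.
Proof. exact: lt_le_trans (freq_seq_ge1 n). Qed.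

Lemma lp_size_gt0 n : 0 < lp_size n.
Proof. by rewrite exprn_gt0 // invr_gt0. Qed.

Let half_ge0 n : 0 <= 2^-1 ^+ n :> R.
Proof. by rewrite exprn_ge0 // invr_ge0. Qed.

Lemma lp_size_half n : lp_size n = 2^-1 ^+ n.+1 * 2^-1 ^+ n.+1.
Proof. by rewrite -exprMn /lp_size; congr (_ ^+ _); field. Qed.

Lemma lp_size_le n : lp_size n <= 2^-1 * 2^-1 ^+ n.
Proof.
rewrite lp_size_half -exprS ler_piMl // exprn_ile1 ?invr_ge0 //.
by rewrite invf_le1 // ler1n.
Qed.

Let lp_size_le1 n : lp_size n <= 2^-1 ^+ n.
Proof.
apply: le_trans (lp_size_le n) _; rewrite ler_piMl //.
by rewrite invf_le1 // ler1n.
Qed.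

Let amp_seq_ge0 n : 0 <= amp_seq n.
Proof. by apply: amp_ge0; exact: ltW (lp_size_gt0 n). Qed.

Let dconst : R := 2 + expR 1.

Let dconst_ge0 : 0 <= dconst. Proof. by rewrite addr_ge0 ?expR_ge0. Qed.

Lemma amp_freq_seq n :
  amp_seq n * freq_seq n = lp_size n * ((j n).+1%:R `^ (2 * p)^-1)^-1.
Proof.
have h : 0 < (j n).+1%:R `^ (2 * p)^-1 :> R by rewrite powR_gt0.
rewrite /amp_seq /amp -/(freq_seq n); field.
by rewrite (gt_eqF h) gt_eqF // freq_seq_gt0.
Qed.

Let width_ge1 n : 1 <= (j n).+1%:R `^ (2 * p)^-1 :> R.
Proof.
by rewrite -[leLHS](powRr0 (j n).+1%:R) ler_powR ?ler1n ?invr_ge0 ?mulr_ge0 ?(ltW p0).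
Qed.

Lemma cmod_dhump_seq_le n t : 0 <= t ->
  cmod (dhump_seq n t) <=
    dconst * lp_size n * (((j n).+1%:R `^ (2 * p)^-1)^-1 * lorentz (j n) t).
Proof.
move=> t0; have := cmod_dhump_le (j n) (freq_seq_ge1 n) (amp_seq_ge0 n) t0.
rewrite amp_freq_seq -/dconst => /le_trans; apply.
by rewrite le_eqVlt; apply/orP; left; apply/eqP; ring.
Qed.

Lemma cmod_dhump_seq_le_weight n t : 0 <= t ->
  cmod (dhump_seq n t) <= dconst * lp_size n.
Proof.
move=> t0; apply: le_trans (cmod_dhump_seq_le n t0) _.
rewrite ler_piMr ?mulr_ge0 ?(ltW (lp_size_gt0 n)) //.
have l0 := ltW (lorentz_gt0 (j n) t); have l1 := lorentz_le1 (j n) t.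
apply: mulr_ile1 => //.
by rewrite invf_le1 // (lt_le_trans ltr01).
Qed.

Lemma geometric_dhump_seq t : 0 <= t -> geometric_bound (dhump_seq ^~ t).
Proof.
move=> t0; exists dconst => n; apply: le_trans (cmod_dhump_seq_le_weight n t0) _.
by rewrite ler_wpM2l.
Qed.

Lemma amp_seq_le n : amp_seq n <= 2^-1 ^+ n.
Proof.
apply: le_trans (lp_size_le1 n).
apply: (@le_trans _ _ (amp_seq n * freq_seq n)); first by rewrite ler_peMr.
rewrite amp_freq_seq ler_piMr ?(ltW (lp_size_gt0 n)) //.
by rewrite invf_le1 // (lt_le_trans ltr01).
Qed.

Lemma geometric_hump_seq t : 0 <= t -> geometric_bound (hump_seq ^~ t).
Proof.
move=> t0; exists 1 => n; rewrite mul1r.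
by apply: le_trans (cmod_hump_le _ _ (amp_seq_ge0 n) t0) (amp_seq_le n).
Qed.

Lemma cmod_transform_sum_le z : Omega alpha z ->
  cmod (transform_sum z) <= (1 + `|complex.Im z|) `^ (alpha / 2).
Proof.
move=> Oz; set P := _ `^ _; have P0 : 0 <= P by exact: powR_ge0.
have -> : P = 2 * (2^-1 * P) by rewrite mulrA divff ?mul1r // pnatr_eq0.
apply: csum_le => n; apply: le_trans (transform_le n Oz) _.
by rewrite -/P mulrAC ler_wpM2r // lp_size_le.
Qed.

Lemma transform_sumE z : 0 < complex.Re z -> transform_sum z = laplace dhump_sum z.
Proof.
move=> z0; rewrite /laplace.
pose e (t : R) : C := cexp (- (z * Complex t 0)).
have eE : e = gexp 0 z by apply/funext => t; rewrite /gexp expr0 mul1r.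
have ce : ccontinuous e by rewrite eE; exact: ccontinuous_gexp.
have cu n : ccontinuous (fun t => e t * dhump_seq n t).
  have -> : (fun t => e t * dhump_seq n t) = fun t =>
      - hump_coef (j n) (amp_seq n) *
      ((j n).+1%:R * gexp (j n) (z + hump_rate (freq_seq n)) t +
       - hump_rate (freq_seq n) * gexp (j n).+1 (z + hump_rate (freq_seq n)) t).
    apply/funext => t; rewrite /dhump_seq /dhump /dgexp -!gexp_shift /e /=; ring.
  by apply: ccontinuousZ; apply: ccontinuousD; apply: ccontinuousZ; exact: ccontinuous_gexp.
rewrite (eq_cintegral (v := fun t => csum (fun n => e t * dhump_seq n t))); last first.
  move=> t /Rplus_ge0 t0; rewrite csumZ //; exact: geometric_dhump_seq.
rewrite (@cintegral_csum _ _ (fun n t => e t * dhump_seq n t)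
   (fun t => dconst * expR (- (complex.Re z * t)))) //.
- congr csum; apply/funext => n.
  by rewrite /transform_seq -laplace_dhump.
- by move=> n; have [] := ccontinuous_measurable (cu n).
- by move=> n; have [] := ccontinuous_measurable (cu n).
- exact: (integrableZl mR dconst (integrable_expRN z0)).
- move=> n t /Rplus_ge0 t0; rewrite cmodM cmod_cexp ReN ReM /= mulr0 subr0.
  rewrite [leRHS]mulrC [dconst * _]mulrC mulrCA ler_wpM2l ?expR_ge0 //.
  apply: le_trans (cmod_dhump_seq_le_weight n t0) _.
  by rewrite [leRHS]mulrC ler_wpM2l.
Qed.

Lemma cintegral_dhump_sum t : 0 <= t -> cintegral `[0, t] dhump_sum = - hump_sum t.
Proof.
move=> t0; have mI : measurable (`[0, t]%classic : set (measurableTypeR R)).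
  exact: measurable_itv.
have It s : `[0, t]%classic s -> 0 <= s by rewrite /= in_itv /= => /andP[].
have mc n := ccontinuous_dhump (j n) (freq_seq n) (amp_seq n).
rewrite (@cintegral_csum _ _ dhump_seq (fun=> dconst)) //.
- rewrite -mulN1r -csumZ; last exact: geometric_hump_seq.
  by congr csum; apply/funext => n; rewrite /dhump_seq cintegral_dhump // mulN1r.
- by move=> n; apply: measurable_funTS; apply: continuous_measurable_fun; case: (mc n).
- by move=> n; apply: measurable_funTS; apply: continuous_measurable_fun; case: (mc n).
- apply: continuous_compact_integrable; first exact: segment_compact.
  by apply: continuous_subspaceT => x; exact: cvg_cst.
- move=> n s /It s0; apply: le_trans (cmod_dhump_seq_le_weight n s0) _.
  by rewrite ler_wpM2l.
Qed.

Lemma transform_sum0 : transform_sum 0 = 0.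
Proof.
rewrite -[RHS]csum0; congr csum; apply/funext => n.
by rewrite /transform_seq /hump_transform mul0r mulr0.
Qed.

Lemma Omega_Re z : Omega alpha z -> -1 < complex.Re z.
Proof.
rewrite /Omega /=; apply: le_lt_trans; rewrite lerN2 div1r invf_le1.
  by rewrite -[leLHS](powRr0 (1 + `|complex.Im z|)) ler_powR ?lerDl // ltW.
by apply: powR_gt0; rewrite ltr_wpDr.
Qed.

(** All but finitely many frequencies are at distance at least 2 from the point;
    for the remaining ones the lower bound 1 + Re z > 0 is enough. *)
Lemma holomorphic_transform_sum : holomorphic_on (Omega alpha) transform_sum.
Proof.
move=> z /Omega_Re z1; pose m0 := (complex.Re z + 1) / 2.
have m00 : 0 < m0 by rewrite /m0; lra.
pose N := (Num.truncn (`|complex.Im z| + m0)).+1.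
have NP n : (N <= n)%N -> `|complex.Im z| + m0 <= n%:R.
  by move=> Nn; rewrite (le_trans (ltW (truncnS_gt _))) // ler_nat.
pose m n := if (N <= n)%N then 2 else m0.
have mP n : 0 < m n by rewrite /m; case: ifP.
have far n (h : C) : (N <= n)%N -> cmod h <= m0 -> 2 <= cmod (z + h + hump_rate (freq_seq n)).
  move=> Nn hh; apply: le_trans (le_Im_cmod _); rewrite !ImD /=.
  have := NP n Nn; have := freq_seq_ge n; have := le_Im_cmod h => h1 h2 h3.
  rewrite -normrN; apply: le_trans (ler_norm _).
  have := ler_norm (complex.Im z); have := ler_norm (complex.Im h); lra.
have mle n (h : C) : cmod h <= m0 -> m n <= cmod (z + h + hump_rate (freq_seq n)).
  move=> hh; rewrite /m; case: ifP => [Nn|_]; first exact: far.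
  apply: le_trans (le_Re_cmod _); rewrite !ReD /=; apply: le_trans (ler_norm _).
  have := le_Re_cmod h; have := ler_norm (- complex.Re h); rewrite normrN /m0 in hh *.
  by move=> h1 h2; lra.
apply: (@derivable_csum _ transform_seq
  (fun n => hump_transform_deriv (j n) (freq_seq n) (amp_seq n) z)
  (fun n => hump_remainder (j n) (freq_seq n) (amp_seq n) (m n)) z m0) => //.
- by move=> n; apply: hump_remainder_ge0.
- apply: (@geometric_bound_near _ _ 1 N) => n Nn.
  rewrite cmod_real mul1r ger0_norm; last by apply: hump_remainder_ge0.
  apply: le_trans (lp_size_le1 n); rewrite /m Nn; exact: remainder_le.
- move=> h hh; apply: (@geometric_bound_near _ _ 1 N) => n Nn.
  rewrite mul1r; apply: le_trans (lp_size_le1 n); apply: transform_far.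
  exact: far.
- move=> n h hh; apply: hump_transform_taylor => //; last exact: mle.
  by have := mle n 0; rewrite cmod0 addr0; apply; exact: ltW.
Qed.


Hypothesis amp_later : forall m n, (m < n)%N ->
  amp_seq n <= 8^-1 * 2^-1 ^+ n.+1 * amp_seq m.
Hypothesis hump_earlier : forall m n t, (m < n)%N -> (j n).+1%:R <= t ->
  cmod (hump_seq m t) <= 8^-1 * 2^-1 ^+ m.+1 * amp_seq n.

(** At the location of one hump the earlier ones have decayed and the later ones
    are lower: together they amount to at most an eighth of its height. *)
Lemma hump_sum_ge n t :
  (j n).+1%:R <= t <= (j n).+1%:R + Num.sqrt (j n).+1%:R / 2 ->
  amp_seq n / 2 <= cmod (hump_sum t).
Proof.
move=> It; have kt : (j n).+1%:R <= t by case/andP: It.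
have t0 : 0 <= t by apply: le_trans kt.
have big := cmod_hump_ge (freq_seq n) (amp_seq_ge0 n) It.
have small : cmod (hump_sum t - hump_seq n t) <= amp_seq n / 8.
  apply: csum_closed; first exact: geometric_hump_seq.
  exists n.+1 => // N /= nN.
  rewrite (bigD1_seq n) ?iota_uniq ?mem_index_iota //= addrAC subrr add0r big_mkcond /=.
  rewrite (le_trans (cmod_sum _ _)) //.
  apply: (@le_trans _ _ (\sum_(0 <= i < N) (amp_seq n / 16 * 2^-1 ^+ i))).
    apply: ler_sum => i _; case: ifP => [ni|_]; last first.
      by rewrite cmod0 mulr_ge0 // divr_ge0.
    rewrite (_ : _ * _ = 8^-1 * 2^-1 ^+ i.+1 * amp_seq n); last by rewrite exprS; field.
    case: (ltngtP i n) => [lt_in|lt_ni|/eqP]; first exact: hump_earlier.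
      apply: le_trans (cmod_hump_le _ _ (amp_seq_ge0 i) t0) _; exact: amp_later.
    by rewrite (negPf ni).
  rewrite -mulr_sumr; have := ler_wpM2l (_ : 0 <= amp_seq n / 16) (@sum_half_le R N).
  move=> h; apply: (le_trans (h _)); first by rewrite divr_ge0.
  by lra.
have := cmodB (hump_sum t) (hump_sum t - hump_seq n t).
rewrite opprB addrC subrK; move: big small (amp_seq_ge0 n).
rewrite -/(hump_seq n); lra.
Qed.

Let majorant n t : R :=
  dconst `^ p * 2^-1 ^+ n.+1 * (Num.sqrt (j n).+1%:R)^-1 * lorentz (j n) t.

Let majorant_ge0 n t : 0 <= majorant n t.
Proof.
have l0 := ltW (lorentz_gt0 (j n) t).
apply: mulr_ge0 => //; apply: mulr_ge0; last by rewrite invr_ge0 sqrtr_ge0.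
by apply: mulr_ge0 => //; exact: powR_ge0.
Qed.

Lemma dhump_seq_majorant n t : 0 <= t ->
  (2 ^+ n.+1 * cmod (dhump_seq n t)) `^ p <= majorant n t.
Proof.
move=> t0; set q := (j n).+1%:R `^ (2 * p)^-1.
have q0 : 0 < q by rewrite powR_gt0.
have l0 := lorentz_gt0 (j n) t; have l1 := lorentz_le1 (j n) t.
have qi0 : 0 <= q^-1 by rewrite invr_ge0 ltW.
have ql0 : 0 <= q^-1 * lorentz (j n) t by apply: mulr_ge0 => //; exact: ltW.
have le1 (x : R) : 0 < x -> x <= 1 -> x `^ p <= x.
  by move=> x0 x1; rewrite ge1r_powR // x0.
apply: (@le_trans _ _ ((dconst * 2^-1 ^+ n.+1 * (q^-1 * lorentz (j n) t)) `^ p)).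
  apply: ge0_ler_powR; rewrite ?nnegrE ?(ltW p0) //.
  - by rewrite mulr_ge0 ?cmod_ge0 ?exprn_ge0.
  - by apply: mulr_ge0 => //; exact: mulr_ge0.
  - apply: le_trans (ler_wpM2l _ (cmod_dhump_seq_le n t0)) _; first by rewrite exprn_ge0.
    rewrite -/q lp_size_half !mulrA ler_wpM2r ?(ltW l0) // ler_wpM2r //.
    rewrite [2 ^+ _ * dconst]mulrC -(mulrA dconst) -exprMn divff ?pnatr_eq0 // expr1n mulr1.
    by [].
rewrite powRM //; last by rewrite mulr_ge0.
rewrite powRM // powRM ?(ltW l0) //.
rewrite invr_powR ?(ltW q0) // /q -powRrM (_ : (2 * p)^-1 * p = 2^-1); last first.
  by field; rewrite gt_eqF.
rewrite powR12_sqrt // /majorant mulrA.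
apply: ler_pM; rewrite ?powR_ge0 //.
- by rewrite !mulr_ge0 ?powR_ge0 ?invr_ge0 ?sqrtr_ge0.
- rewrite ler_wpM2r ?invr_ge0 ?sqrtr_ge0 // ler_wpM2l ?powR_ge0 //.
  apply: le1; first by rewrite exprn_gt0 // invr_gt0.
  by rewrite exprn_ile1 ?invr_ge0 // invf_le1 // ler1n.
- exact: le1 (lorentz_le1 _ _).
Qed.

Lemma integral_majorant_le n :
  (\int[mu]_(t in Rplus) (majorant n t)%:E <=
   (dconst `^ p * (8 * pi) * 2^-1 ^+ n)%:E)%E.
Proof.
pose c := dconst `^ p * 2^-1 ^+ n.+1 * (Num.sqrt (j n).+1%:R)^-1.
have c0 : 0 <= c by rewrite mulr_ge0 ?invr_ge0 ?sqrtr_ge0 // mulr_ge0 ?powR_ge0.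
have ml : measurable_fun (Rplus : set (measurableTypeR R)) (EFin \o (@lorentz R (j n))).
  exact: (measurable_int _ (integrable_lorentz (j0 n))).
under eq_integral do rewrite /majorant -/c EFinM.
rewrite ge0_integralZl_EFin //; last first.
  by move=> t _; rewrite lee_fin ltW // lorentz_gt0.
apply: le_trans (lee_wpmul2l _ (integral_lorentz_le (j0 n))) _; first by rewrite lee_fin.
rewrite -EFinM lee_fin /c.
have s0 : 0 < Num.sqrt (j n).+1%:R :> R by rewrite sqrtr_gt0.
rewrite [leLHS](_ : _ = dconst `^ p * (8 * pi) * 2^-1 ^+ n.+1); last first.
  by move: (dconst `^ p) (2^-1 ^+ n.+1) => e h; field; rewrite gt_eqF.
rewrite ler_wpM2l ?mulr_ge0 ?powR_ge0 ?pi_ge0 // exprS ler_piMl //.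
by rewrite invf_le1 // ler1n.
Qed.

(** As the numbers 2^-(n+1) add up to 1, the modulus of the sum of the x_n is at
    most the supremum of the 2^(n+1) |x_n|, and the p-th power of that supremum
    is at most the sum of the p-th powers. *)
Lemma cmod_dhump_sum_powR t : 0 <= t ->
  ((cmod (dhump_sum t) `^ p)%:E <= \sum_(n <oo) (majorant n t)%:E)%E.
Proof.
move=> t0.
have term n : ((majorant n t)%:E <= \sum_(n <oo) (majorant n t)%:E)%E.
  have := @nneseries_lim_ge R (fun n => (majorant n t)%:E) xpredT 0%N n.+1
    (fun i _ _ => _); rewrite big_nat_recr //= => h.
  apply: le_trans (h _); last by move=> i; rewrite lee_fin.
  by rewrite leeDr // sume_ge0 // => i _; rewrite lee_fin.
case: (\sum_(n <oo) (majorant n t)%:E)%E term => [r| |] term; last 2 first.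
- by rewrite leey.
- by have := term 0%N; rewrite leeNy_eq.
have {}term n : majorant n t <= r by have := term n; rewrite lee_fin.
have r0 : 0 <= r by apply: le_trans (term 0%N).
rewrite lee_fin.
have le_f : cmod (dhump_sum t) <= r `^ p^-1.
  rewrite (_ : r `^ p^-1 = 2 * (2^-1 * r `^ p^-1)); last by field.
  apply: csum_le => n.
  have P2 : 0 < 2 ^+ n.+1 :> R by rewrite exprn_gt0.
  rewrite -(ler_pM2l P2).
  rewrite [leRHS](_ : _ = r `^ p^-1 * (2 * 2^-1) ^+ n.+1); last first.
    by rewrite exprMn [2^-1 ^+ n.+1]exprS; ring.
  rewrite divff ?pnatr_eq0 // expr1n mulr1.
  have x0 : 0 <= 2 ^+ n.+1 * cmod (dhump_seq n t) by rewrite mulr_ge0 ?cmod_ge0 ?(ltW P2).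
  rewrite [leLHS](_ : _ = ((2 ^+ n.+1 * cmod (dhump_seq n t)) `^ p) `^ p^-1); last first.
    by rewrite -powRrM divff ?gt_eqF // powRr1.
  apply: ge0_ler_powR; rewrite ?nnegrE ?powR_ge0 ?invr_ge0 ?(ltW p0) //.
  exact: le_trans (dhump_seq_majorant n t0) (term n).
have := ge0_ler_powR (ltW p0) _ _ le_f; rewrite !nnegrE => h.
apply: le_trans (h _ _) _; rewrite ?cmod_ge0 ?powR_ge0 //.
by rewrite -powRrM mulVf ?gt_eqF // powRr1.
Qed.

Lemma Lp_dhump_sum : Lp_Rplus p dhump_sum.
Proof.
have [mRe mIm] : measurable_fun (Rplus : set (measurableTypeR R))
    (fun t => complex.Re (dhump_sum t) : measurableTypeR R) /\
  measurable_fun (Rplus : set (measurableTypeR R))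
    (fun t => complex.Im (dhump_sum t) : measurableTypeR R).
  apply: (@measurable_csum _ _ dconst) => [n|n t t0]; first exact: ccontinuous_dhump.
  by apply: le_trans (cmod_dhump_seq_le_weight n t0) _; rewrite ler_wpM2l.
split=> //.
have mM n : measurable_fun (Rplus : set (measurableTypeR R)) (fun t => (majorant n t)%:E).
  apply/measurable_EFinP; apply: measurable_funM => //.
  by apply: measurable_funTS; apply: continuous_measurable_fun; exact: continuous_lorentz.
apply: (@le_lt_trans _ _ (\int[mu]_(t in Rplus) \sum_(n <oo) (majorant n t)%:E)%E).
  apply: ge0_le_integral => //.
  - by move=> t _; rewrite lee_fin powR_ge0.
  - apply/measurable_EFinP; apply: (measurableT_comp (measurable_powR p)).
    exact: measurable_cmod.
  - by apply: ge0_emeasurable_sum => [n t _ _|n _]; [rewrite lee_fin|exact: mM].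
  - by move=> t /Rplus_ge0 t0; exact: cmod_dhump_sum_powR.
rewrite integral_nneseries //; last by move=> n t _; rewrite lee_fin.
apply: (@le_lt_trans _ _ (2 * (dconst `^ p * (8 * pi)))%:E); last exact: ltry.
have i0 n : (0 <= \int[mu]_(t in Rplus) (majorant n t)%:E)%E.
  by apply: integral_ge0 => t _; rewrite lee_fin.
apply: lime_le; first by apply: is_cvg_nneseries => n _ _; exact: i0.
apply: nearW => N.
apply: (le_trans (lee_sum _ (fun n _ => integral_majorant_le n))).
rewrite sumEFin lee_fin -mulr_sumr mulrC ler_wpM2r ?sum_half_le //.
by rewrite mulr_ge0 ?powR_ge0 // mulr_ge0 ?pi_ge0.
Qed.

End Superposition.

(** * Divergence of the weighted integral *)

Section Divergence.
Context {R : realType}.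
Local Notation C := (complex R).
Local Notation mu := (@lebesgue_measure R).

Lemma measurable_weight (alpha p : R) (gamma : R -> R) :
  (forall t, 0 <= t -> 0 < gamma t) -> {within Rplus, continuous gamma} ->
  measurable_fun (Rplus : set (measurableTypeR R))
    (fun t => (t / (gamma t * ln (t + 2))) `^ (p / alpha) : measurableTypeR R).
Proof.
move=> gamma0 cg; have mR := @measurable_Rplus R.
apply: (measurableT_comp (measurable_powR (p / alpha))).
apply: (@eq_measurable_fun _ _ (measurableTypeR R) (measurableTypeR R) Rplus
  (fun t : R => t * (gamma t * ln (t + 2)) `^ (-1))).
  move=> t; rewrite inE => /Rplus_ge0 t0; rewrite powR_inv1 //.
  by rewrite mulr_ge0 ?ln_ge0 ?(ltW (gamma0 t t0)) //; lra.
apply: measurable_funM; first exact: measurable_id.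
apply: (measurableT_comp (measurable_powR (-1))).
apply: measurable_funM; first exact: subspace_continuous_measurable_fun.
apply: (measurableT_comp (@measurable_ln R)).
apply: measurable_funTS; apply: continuous_measurable_fun => x.
by apply: cvgD; [exact: cvg_id|exact: cvg_cst].
Qed.

(** The n-th hump alone contributes at least (n + 1) / 2, so the integral exceeds
    every bound. *)
Lemma integral_weighted_eqy (alpha p : R) (gamma : R -> R) (j : nat -> nat)
    (g : R -> C) :
  0 < alpha -> 1 <= p ->
  (forall t, 0 <= t -> 0 < gamma t) -> {within Rplus, continuous gamma} ->
  measurable_fun (Rplus : set (measurableTypeR R))
    (fun t => complex.Re (g t) : measurableTypeR R) ->
  measurable_fun (Rplus : set (measurableTypeR R))
    (fun t => complex.Im (g t) : measurableTypeR R) ->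
  (forall n, (3 <= j n)%N) ->
  (forall n t, (j n).+1%:R <= t ->
     gamma t <= weight_level alpha p (lp_size n) n.+1%:R) ->
  (forall n t, (j n).+1%:R <= t <= (j n).+1%:R + Num.sqrt (j n).+1%:R / 2 ->
     amp_seq alpha p j n / 2 <= cmod (g t)) ->
  (\int[mu]_(t in Rplus) (cmod (g t) `^ p *
     (t / (gamma t * ln (t + 2))) `^ (p / alpha))%:E = +oo)%E.
Proof.
move=> alpha0 p1 gamma0 cgamma mRe mIm j3 gamma_le g_ge.
have p0 : 0 < p by apply: lt_le_trans p1.
have mR := @measurable_Rplus R.
have mf : measurable_fun (Rplus : set (measurableTypeR R)) (fun t =>
    (cmod (g t) `^ p * (t / (gamma t * ln (t + 2))) `^ (p / alpha))%:E).
  apply/measurable_EFinP; apply: measurable_funM; last exact: measurable_weight.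
  by apply: (measurableT_comp (measurable_powR p)); exact: measurable_cmod.
apply/eqyP => A A0.
pose n := Num.truncn (2 * A).
have An : 2 * A <= n.+1%:R by rewrite ltW // truncnS_gt.
set K : R := (j n).+1%:R; pose I : set R := `[K, K + Num.sqrt K / 2]%classic.
have K0 : 0 < K by rewrite ltr0n.
have sK : 0 < Num.sqrt K by rewrite sqrtr_gt0.
have mI : measurable (I : set (measurableTypeR R)) by exact: measurable_itv.
have IR : I `<=` Rplus.
  move=> t; rewrite /I /Rplus /= !in_itv /= andbT => /andP[Kt _].
  by apply: le_trans Kt; exact: ltW.
have f0 t : (0 <= (cmod (g t) `^ p * (t / (gamma t * ln (t + 2))) `^ (p / alpha))%:E)%E.
  by rewrite lee_fin mulr_ge0 // powR_ge0.
have sub := ge0_subset_integral mu mI mR mf (fun t _ => f0 t) IR.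
apply: le_trans sub.
pose c := n.+1%:R `^ p / Num.sqrt K.
apply: (@le_trans _ _ (\int[mu]_(t in I) (cst c%:E) t)%E); last first.
  apply: ge0_le_integral => //.
  - by move=> t _; rewrite lee_fin divr_ge0 ?powR_ge0 ?sqrtr_ge0.
  - exact: (measurable_funS mR IR).
  - move=> t It; have := It; rewrite /I /= in_itv /= => It'.
    have t0 : 0 <= t by apply: Rplus_ge0; exact: IR.
    rewrite lee_fin.
    have gam : 0 < gamma t <= weight_level alpha p (lp_size n) n.+1%:R.
      by rewrite gamma0 //= gamma_le //; case/andP: It'.
    apply: le_trans (weighted_amp_ge alpha0 p1 (lp_size_gt0 n) (ltr0Sn R n)
      (_ : (3 < (j n).+1)%N) It' gam) _; first by rewrite ltnS.
    rewrite ler_wpM2r ?powR_ge0 //; apply: ge0_ler_powR; rewrite ?nnegrE ?cmod_ge0 ?(ltW p0) //.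
      by rewrite divr_ge0 // amp_ge0 // ltW // lp_size_gt0.
    exact: g_ge.
have muI : mu I = (Num.sqrt K / 2)%:E.
  rewrite /I lebesgue_measure_itv /= lte_fin ltrDl divr_gt0 //.
  by rewrite -EFinB addrAC subrr add0r.
rewrite integral_cst; last exact: mI.
rewrite [X in (_ * X)%E]muI -EFinM lee_fin /c.
have -> : n.+1%:R `^ p / Num.sqrt K * (Num.sqrt K / 2) = n.+1%:R `^ p / 2.
  by field; rewrite gt_eqF.
by rewrite ler_pdivlMr // mulrC (le_trans An) // le1r_powR // ler1n.
Qed.

Lemma near_gamma_le (gamma : R -> R) (e : R) :
  gamma t @[t --> +oo] --> (0 : R) -> 0 < e ->
  \forall j \near \oo, forall t, j.+1%:R <= t -> gamma t <= e.
Proof.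
move=> g0 e0; have [M [_ hM]] := (@cvgrPdist_le _ _ _ _ _ _ _).1 g0 e e0.
near=> j => t jt; apply: le_trans (ler_norm _) _; rewrite -normrN -[- _]add0r.
apply: hM; apply: lt_le_trans jt; rewrite -addn1 natrD ltr_pwDr //.
by near: j; exact: nbhs_infty_ger.
Unshelve. all: by end_near. Qed.

End Divergence.

Theorem theorem5p1 (R : realType) (alpha p : R) (gamma : R -> R)
    (halpha : 0 < alpha) (hp : 1 <= p)
    (gamma_gt0 : forall t : R, 0 <= t -> 0 < gamma t)
    (gamma_C0 : C0_Rplus gamma) :
  exists f : R -> complex R, Lp_Rplus p f /\
    exists F : complex R -> complex R,
      [/\ laplace_extension f (Omega alpha) F,
          (forall z : complex R, Omega alpha z ->
             cmod (F z) <= (1 + `|complex.Im z|) `^ (alpha / 2)) &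
          (\int[@lebesgue_measure R]_(t in Rplus)
             ((cmod (F 0%R - cintegral `[0%R, t] f) `^ p *
              (t / (gamma t * ln (t + 2))) `^ (p / alpha))%:E) = +oo)%E].
Proof.
have [cgamma gamma0] := gamma_C0.
have d0 n : 0 < lp_size n :> R by exact: lp_size_gt0.
pose fr k : R := freq alpha p k.+1.
pose am n k : R := amp alpha p (lp_size n) k.+1.
(* A collects the requirements on the location of the n-th hump alone, B those
   relative to an earlier hump; the guard in B is there because the height is 0
   at location 1, where ln k = 0 *)
pose A n k := [/\ (3 <= k)%N, n%:R + 4 <= fr k,
  (forall (d : R) (z : complex R), 0 <= d -> Omega alpha z ->
     cmod (hump_transform k (fr k) (amp alpha p d k.+1) z) <=
     d * (1 + `|complex.Im z|) `^ (alpha / 2)) /\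
  (forall (d : R) (z : complex R), 0 <= d -> 2 <= cmod (z + hump_rate (fr k)) ->
     cmod (hump_transform k (fr k) (amp alpha p d k.+1) z) <= d),
  (forall d m : R, 0 <= d -> 2 <= m ->
     hump_remainder k (fr k) (amp alpha p d k.+1) m <= d) &
  (forall t, k.+1%:R <= t -> gamma t <= weight_level alpha p (lp_size n) n.+1%:R)].
pose B m i n k := (0 < am m i -> am n k <= 8^-1 * 2^-1 ^+ n.+1 * am m i) /\
  (forall t, k.+1%:R <= t ->
     cmod (hump i (fr i) (am m i) t) <= 8^-1 * 2^-1 ^+ m.+1 * am n k).
have nearA n : \forall k \near \oo, A n k.
  have N1 : \forall k \near \oo, (3 <= k)%N by exact: nbhs_infty_ge.
  have N2 := near_succ (near_freq_ge (n%:R + 4) halpha hp).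
  have N3 := near_hump_transform_le halpha hp.
  have N4 := near_hump_transform_far halpha hp.
  have N5 := near_hump_remainder_le halpha hp.
  have w0 := weight_level_gt0 halpha hp (d0 n) (ltr0Sn R n).
  have N6 := near_gamma_le gamma0 w0.
  apply: filterS (filterI N1 (filterI N2 (filterI N3 (filterI N4 (filterI N5 N6))))).
  by move=> k [h1 [h2 [h3 [h4 [h5 h6]]]]].
have nearB m i n : \forall k \near \oo, B m i n k.
  have amp0 : 0 <= am m i by apply: amp_ge0; exact: ltW.
  have N1 : \forall k \near \oo, 0 < am m i -> am n k <= 8^-1 * 2^-1 ^+ n.+1 * am m i.
    have [ap|ap] := ltP 0 (am m i); last exact: nearW.
    have M0 : 0 < 8^-1 * 2^-1 ^+ n.+1 * am m i.
      by apply: mulr_gt0 => //; rewrite mulr_gt0 ?invr_gt0 // exprn_gt0 // invr_gt0.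
    by apply: filterS (near_succ (near_amp_le halpha hp (ltW (d0 n)) M0)) => k h _.
  have M0 : 0 <= 8 * 2 ^+ m.+1 * (am m i * bump_norm i.+1).
    apply: mulr_ge0; first by rewrite mulr_ge0 ?exprn_ge0.
    by apply: mulr_ge0 => //; exact: ltW (bump_norm_gt0 _).
  have N2 := near_succ (near_amp_ge i.+1 halpha hp (d0 n) M0).
  apply: filterS (filterI N1 N2) => k [h1 h2]; split=> // t kt.
  have t0 : 0 <= t by apply: le_trans kt.
  rewrite cmod_hump // exprVn.
  rewrite (_ : 8^-1 * _ * _ = am n k / (8 * 2 ^+ m.+1)); last by rewrite invfM mulrC.
  rewrite ler_pdivlMr ?mulr_gt0 ?exprn_gt0 //; apply: le_trans (h2 t kt).
  by rewrite le_eqVlt; apply/orP; left; apply/eqP; ring.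
have [j [jA jB]] := sparse_choice nearA nearB.
have j3 n : (3 <= j n)%N by case: (jA n).
have fr_ge n : n%:R + 4 <= freq_seq alpha p j n by case: (jA n).
have F_le n z : Omega alpha z -> cmod (transform_seq alpha p j n z) <=
    lp_size n * (1 + `|complex.Im z|) `^ (alpha / 2).
  by case: (jA n) => _ _ [h _] _ _; apply: h; exact: ltW.
have F_far n z : 2 <= cmod (z + hump_rate (freq_seq alpha p j n)) ->
    cmod (transform_seq alpha p j n z) <= lp_size n.
  by case: (jA n) => _ _ [_ h] _ _; apply: h; exact: ltW.
have rem_le n m : 2 <= m ->
    hump_remainder (j n) (freq_seq alpha p j n) (amp_seq alpha p j n) m <= lp_size n.
  by case: (jA n) => _ _ _ h _; apply: h; exact: ltW.
have gamma_le n t : (j n).+1%:R <= t ->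
    gamma t <= weight_level alpha p (lp_size n) n.+1%:R.
  by case: (jA n) => _ _ _ _; apply.
have amp_gt0 n : 0 < am n (j n).
  apply: divr_gt0 => //; apply: mulr_gt0; last exact: powR_gt0.
  by apply: lt_le_trans (fr_ge n); rewrite ltr_wpDl.
have later m n : (m < n)%N ->
    amp_seq alpha p j n <= 8^-1 * 2^-1 ^+ n.+1 * amp_seq alpha p j m.
  by move=> mn; case: (jB m n mn) => h _; exact: h.
have earlier m n t : (m < n)%N -> (j n).+1%:R <= t ->
    cmod (hump_seq alpha p j m t) <= 8^-1 * 2^-1 ^+ m.+1 * amp_seq alpha p j n.
  by move=> mn; case: (jB m n mn) => _; apply.
exists (dhump_sum alpha p j); split; first exact: Lp_dhump_sum.
exists (transform_sum alpha p j); split.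
- split; last by move=> z z0; exact: transform_sumE.
    move=> z; rewrite /right_half_plane /Omega /= => z0; apply: lt_trans z0.
    by rewrite oppr_lt0 divr_gt0 // powR_gt0 // ltr_wpDr.
  exact: holomorphic_transform_sum.
- by move=> z; exact: cmod_transform_sum_le.
rewrite transform_sum0.
have [mRe mIm] : measurable_fun (Rplus : set (measurableTypeR R))
    (fun t => complex.Re (hump_sum alpha p j t) : measurableTypeR R) /\
  measurable_fun (Rplus : set (measurableTypeR R))
    (fun t => complex.Im (hump_sum alpha p j t) : measurableTypeR R).
  apply: (@measurable_csum _ _ 1) => [n|n t t0]; first exact: ccontinuous_hump.
  rewrite mul1r; apply: le_trans (amp_seq_le hp fr_ge n).
  exact: (cmod_hump_le _ _ (ltW (amp_gt0 n)) t0).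
have g_ge n t (It : (j n).+1%:R <= t <= (j n).+1%:R + Num.sqrt (j n).+1%:R / 2) :=
  hump_sum_ge hp fr_ge later earlier It.
apply: etrans (integral_weighted_eqy halpha hp gamma_gt0 cgamma mRe mIm j3 gamma_le g_ge).
apply: eq_integral => t; rewrite inE => /Rplus_ge0 t0.
by rewrite (cintegral_dhump_sum hp fr_ge t0) opprK add0r.
Qed.
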